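(* Let $p\ge5$ be a prime, let $r=(p-1)/2$, and let $\mathbf{Q}^+=\mathbf{Q}(\zeta_p+\zeta_p^{-1})$. Let $K$ be a $D_p$-extension with a unique real embedding. For each class $[\mathfrak{a}]\in\mathrm{Cl}(\mathbf{Q}^+)$, with chosen representative ideal $\mathfrak{a}$ and chosen $\mathbf{Z}$-basis $B_{\mathfrak{a}}$ of $\mathfrak{a}$, let $\mathcal{O}_{[\mathfrak{a}]}\subseteq\mathcal{G}_r$ be the image of $G_{\mathrm{unit}}$ under the action of $M_{\mathfrak{a}}\mathcal{T}_p$, and let $[\mathcal{O}_{[\mathfrak{a}]}]$ be its image in $\mathcal{S}_r=\mathrm{GL}_r(\mathbf{Z})\backslash\mathcal{G}_r$. Then: (1) for each $[\mathfrak{a}]\in\mathrm{Cl}(\mathbf{Q}^+)$, the torus orbit $\mathcal{O}_{[\mathfrak{a}]}$ is a translate of a periodic torus orbit in $\mathcal{G}_r$, and the quotient $[\mathcal{O}_{[\mathfrak{a}]}]\subseteq\mathcal{S}_r$ is independent of the choice of representative ideal $\mathfrak{a}$ and basis $B_{\mathfrak{a}}$; (2) the unit shape of $K$ is contained in $[\mathcal{O}_{[\mathfrak{a}]}]$ for some $[\mathfrak{a}]\in\mathrm{Cl}(\mathbf{Q}^+)$.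
   Context: A $D_p$-extension is a number field $K$ of degree $p$ over $\mathbf{Q}$ whose Galois closure over $\mathbf{Q}$ has Galois group isomorphic to the dihedral group $D_p$ of order $2p$. Unit shape. Let $K$ be a $D_p$-extension with unique real embedding $\iota$ and pairs of complex conjugate embeddings $\tau_1,\overline{\tau_1},\dots,\tau_r,\overline{\tau_r}$. Let $E_K=\mathcal{O}_K^\times/\text{torsion}$. The logarithmic embedding $\mathrm{Log}\colon E_K\to\mathbf{R}^{r+1}$, $u\mapsto(\log|\iota(u)|,2\log|\tau_1(u)|,\dots,2\log|\tau_r(u)|)$, presents $E_K$ as a lattice of rank $r$ (standard inner product on $\mathbf{R}^{r+1}$). The shape of a lattice is its equivalence class under scaling, rotation and reflection; the unit shape of $K$ is the shape of this lattice. Space of shapes. $\mathcal{G}_r$ is the space of real symmetric positive definite $r\times r$ matrices up to (positive real) scaling; $M\in\mathrm{GL}_r(\mathbf{R})$ acts on $\mathcal{G}_r$ by $G\mapsto MGM^T$. The space of shapes of rank $r$ lattices is $\mathcal{S}_r=\mathrm{GL}_r(\mathbf{Z})\backslash\mathcal{G}_r$, the shape of a lattice being the class of the Gram matrix of any $\mathbf{Z}$-basis. The matrix $G_{\mathrm{unit}}$. $\zeta_p$ is a primitive $p$-th root of unity, and $A^+=\mathbf{Z}[\zeta_p+\zeta_p^{-1}]$ is the ring of integers of $\mathbf{Q}^+$, with $\mathbf{Z}$-basis $B=[1,\zeta_p+\zeta_p^{-1},\dots,\zeta_p^{r-1}+\zeta_p^{1-r}]$. Let $G$ be the Gram matrix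 of the trace form $(x,y)\mapsto\mathrm{Tr}_{\mathbf{Q}^+/\mathbf{Q}}(xy)$ in the basis $B$. Let $\widetilde{G}$ be the $r\times(r+1)$ matrix obtained by appending to $G$ a last column whose $j$-th entry is $-\sum_{i=1}^rG_{ji}$. Set $G_{\mathrm{unit}}=\widetilde{G}\widetilde{G}^T$. The torus $\mathcal{T}_p$. Let $\mathcal{T}$ be the group of invertible diagonal matrices in $\mathrm{GL}_r(\mathbf{R})$. Let $j_1,\dots,j_r$ be the embeddings of $\mathbf{Q}^+$ into $\mathbf{R}$, ordered so that $j_i(\zeta_p+\zeta_p^{-1})=\zeta_p^i+\zeta_p^{-i}$. Let $P$ be the $r\times r$ matrix whose $(k,i)$ entry is $j_i$ applied to the $k$-th element of $B$. Set $\mathcal{T}_p=P\mathcal{T}P^{-1}$. The orbits. For each class $[\mathfrak{a}]\in\mathrm{Cl}(\mathbf{Q}^+)$ pick a representative ideal $\mathfrak{a}$ and a $\mathbf{Z}$-basis $B_{\mathfrak{a}}=[v_1,\dots,v_r]$ of $\mathfrak{a}$, and let $M_{\mathfrak{a}}$ be the matrix with $M_{\mathfrak{a}}B^T=B_{\mathfrak{a}}^T$. Then $\mathcal{O}_{[\mathfrak{a}]}=\{M_{\mathfrak{a}}\,t\,G_{\mathrm{unit}}\,t^T M_{\mathfrak{a}}^T: t\in\mathcal{T}_p\}\subseteq\mathcal{G}_r$. Terminology. A subset of $\mathcal{G}_r$ is a translate of a periodic torus orbit if it has the form $\{(gth)(gth)^T: t\in\mathcal{T}\}$ (up to scaling)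 for some $g,h\in\mathrm{GL}_r(\mathbf{R})$ such that the $\mathcal{T}$-orbit of the class of $g$, i.e. the image of $g\mathcal{T}$ in $\mathrm{GL}_r(\mathbf{Z})\backslash\mathrm{GL}_r(\mathbf{R})/\mathbf{R}^\times$, is compact (periodic). *)

(* Defs.v *)
From HB Require Import structures.
From mathcomp Require Import all_boot all_order all_fingroup all_algebra.
From mathcomp Require Import all_solvable all_field.
From mathcomp Require Import complex.
From mathcomp Require Import generic_quotient ring.
From mathcomp Require Import all_classical all_reals all_analysis.

Set Implicit Arguments.
Unset Strict Implicit.
Unset Printing Implicit Defensive.

Import Order.TTheory GRing.Theory Num.Theory.
Import numFieldNormedType.Exports.

Local Open Scope classical_set_scope.
Local Open Scope ring_scope.

Definition Zbasis (V : zmodType) (r : nat) (L : set V) (v : 'I_r -> V) : Prop :=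
  L = [set \sum_(k < r) v k *~ c k | c in [set: 'I_r -> int]] /\
  (forall c : 'I_r -> int, \sum_(k < r) v k *~ c k = 0 -> forall k, c k = 0).

(* A point of the space G_r is a positive definite matrix up to positive
   scaling; a subset of G_r is represented by the set of all matrices whose
   class belongs to it.  A point of S_r = GL_r(Z) \ G_r is represented by the
   corresponding equivalence class of matrices. *)
Section Shapes.
Variables (R : realType) (r : nat).
Implicit Types (G X : 'M[R]_r) (O : set 'M[R]_r).

Definition GLZ : set 'M[R]_r :=
  [set map_mx intr U | U in [set U : 'M[int]_r | U \in unitmx]].

Definition shape_class G : set 'M[R]_r :=
  [set X | exists (c : R) (U : 'M[R]_r),
             [/\ 0 < c, GLZ U & X = c *: (U *m G *m U^T)]].

Definition shape_image O : set (set 'M[R]_r) := [set shape_class G | G in O].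

(* The common class of all Gram matrices of Z-bases of L. *)
Definition lattice_shape (n : nat) (L : set 'rV[R]_n) : set 'M[R]_r :=
  [set X | exists2 b : 'M[R]_(r, n),
             Zbasis L (fun k => row k b) & shape_class (b *m b^T) X].

Definition diag_torus : set 'M[R]_r :=
  [set diag_mx d | d in [set d : 'rV[R]_r | forall i, d 0 i != 0]].

End Shapes.

(* GL_r(Z) \ GL_r(R) / R^*, with the quotient topology *)
Section LatticeSpace.
Variables (R : realType) (r : nat).

Definition GLR : set 'M[R]_r := [set g | g \in unitmx].

Definition homothetic (X Y : GLR) : bool :=
  `[< exists (c : R) (U : 'M[R]_r),
        [/\ c != 0, GLZ U & set_val Y = c *: (U *m set_val X)] >].

Lemma GLZ1 : @GLZ R r 1%:M.
Proof. by exists 1%:M; [exact: unitmx1 | rewrite map_mx1]. Qed.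

Lemma GLZM (U V : 'M[R]_r) : GLZ U -> GLZ V -> GLZ (U *m V).
Proof.
case=> A /= uA <- [B /= uB <-]; exists (A *m B); last by rewrite map_mxM.
by rewrite /= unitmx_mul uA.
Qed.

Lemma GLZV (U : 'M[R]_r) : GLZ U -> exists2 V, GLZ V & V *m U = 1%:M.
Proof.
case=> A /= uA <-; exists (map_mx intr (invmx A)).
  by exists (invmx A); rewrite //= unitmx_inv.
by rewrite -map_mxM mulVmx // map_mx1.
Qed.

Lemma homothetic_refl : reflexive homothetic.
Proof.
move=> X; apply/asboolP; exists 1, 1%:M.
by split; [exact: oner_neq0 | exact: GLZ1 | rewrite mul1mx scale1r].
Qed.

Lemma homothetic_sym : symmetric homothetic.
Proof.
suff H X Y : homothetic X Y -> homothetic Y X.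
  by move=> X Y; apply/idP/idP; exact: H.
move=> /asboolP[c [U [c0 /GLZV[V VZ VU] E]]]; apply/asboolP; exists c^-1, V.
split=> //; first by rewrite invr_eq0.
by rewrite E -scalemxAr scalerA mulVf // scale1r mulmxA VU mul1mx.
Qed.

Lemma homothetic_trans : transitive homothetic.
Proof.
move=> Y X Z /asboolP[c [U [c0 UZ E]]] /asboolP[d [V [d0 VZ F]]].
apply/asboolP; exists (d * c), (V *m U); split; first by rewrite mulf_neq0.
  exact: GLZM.
by rewrite F E -scalemxAr scalerA mulmxA.
Qed.

Definition homothetic_equiv : equiv_rel GLR :=
  EquivRel homothetic homothetic_refl homothetic_sym homothetic_trans.

Definition lattice_space : topologicalType :=
  quotient_topology {eq_quot homothetic_equiv}%qT.

Definition lattice_class (g : GLR) : lattice_space :=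
  (\pi_({eq_quot homothetic_equiv}) g)%qT.

Definition periodic (g : 'M[R]_r) : Prop :=
  compact (lattice_class @`
    [set x | exists2 t, diag_torus t & set_val x = g *m t]).

Definition is_translate_of_periodic_orbit (O : set 'M[R]_r) : Prop :=
  exists g h : 'M[R]_r,
    [/\ g \in unitmx, h \in unitmx, periodic g &
        O = [set X | exists (c : R) (t : 'M[R]_r),
               [/\ 0 < c, diag_torus t &
                   X = c *: ((g *m t *m h) *m (g *m t *m h)^T)]]].

End LatticeSpace.

(* Q^+ = Q(z + 1/z), for z a primitive p-th root of unity in some number
   field F. *)
Section RealCyclotomic.
Variables (F : fieldExtType rat) (z : F).

Definition Qplus_space : {subfield F} := <<1; z + z^-1>>%AS.
Definition Qplus : fieldExtType rat := subvs_of Qplus_space.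

(* vsproj casts elements of F lying in Q^+ to the type Qplus. *)
Definition Bplus (k : nat) : Qplus :=
  vsproj Qplus_space (if k == 0%N then 1 else z ^+ k + z ^- k).

Lemma Bplus_val (k : nat) : z != 0 ->
  vsval (Bplus k) = if k == 0%N then 1 else z ^+ k + z ^- k.
Proof.
move=> z0; apply: vsprojK; case: eqP => // _; first exact: mem1v.
suff: (z ^+ k + z ^- k \in Qplus_space) /\
      (z ^+ k.+1 + z ^- k.+1 \in Qplus_space) by case.
have w_in : z + z^-1 \in Qplus_space by exact: memv_adjoin.
elim: k => [|k [IH1 IH2]].
  by rewrite expr0 invr1 expr1 w_in; split=> //; rewrite rpredD ?mem1v.
split=> //.
have -> : z ^+ k.+2 + z ^- k.+2 =
    (z + z^-1) * (z ^+ k.+1 + z ^- k.+1) - (z ^+ k + z ^- k).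
  rewrite -!exprVn !exprS; have : z * z^-1 = 1 by exact: divff.
  move: (z^-1) => y zy; rewrite [RHS](_ : _ =
    z * (z * z ^+ k) + y * (y * y ^+ k) + (z * y - 1) * (z ^+ k + y ^+ k)).
    by rewrite zy subrr mul0r addr0.
  by ring.
by rewrite rpredB ?rpredM.
Qed.

Definition Aplus : set Qplus :=
  [set (map_poly intr q).[Bplus 1] | q in [set: {poly int}]].

Definition fractional_ideal (I : set Qplus) : Prop :=
  [/\ exists2 x, I x & x != 0,
      I 0 /\ forall x y, I x -> I y -> I (x - y),
      forall a x, Aplus a -> I x -> I (a * x) &
      exists2 d, Aplus d /\ d != 0 & forall x, I x -> Aplus (d * x)].

Definition ideal_class (I : set Qplus) : set (set Qplus) :=
  [set J | exists2 x, x != 0 & J = [set x * y | y in I]].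

Definition ideal_classes : set (set (set Qplus)) :=
  [set ideal_class I | I in fractional_ideal].

Definition Qplus_trace (x : Qplus) : rat :=
  \tr (passmx.mxof (vbasis {:Qplus}) (vbasis {:Qplus}) (amull x)).

Section Orbits.
Variables (R : realType) (r : nat) (j : 'I_r -> {rmorphism Qplus -> R}).

Definition Gtrace : 'M[rat]_r :=
  \matrix_(k, l) Qplus_trace (Bplus k * Bplus l).

Definition Gtilde : 'M[rat]_(r, r + 1) :=
  row_mx Gtrace (\col_k - \sum_(i < r) Gtrace k i).

Definition Gunit : 'M[R]_r := map_mx ratr (Gtilde *m Gtilde^T).

Definition Pmx : 'M[R]_r := \matrix_(k, i) j i (Bplus k).

Definition Tp : set 'M[R]_r :=
  [set Pmx *m t *m invmx Pmx | t in @diag_torus R r].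

(* M B^T = v^T *)
Definition is_coord_mx (v : 'I_r -> Qplus) (M : 'M[rat]_r) : Prop :=
  forall k, v k = \sum_(l < r) M k l *: Bplus l.

(* M is unique, because B is a Q-basis of Q^+. *)
Definition torus_orbit (v : 'I_r -> Qplus) : set 'M[R]_r :=
  [set X | exists (M : 'M[rat]_r) (c : R) (t : 'M[R]_r),
     [/\ is_coord_mx v M, 0 < c, Tp t &
         X = c *: (map_mx ratr M *m t *m Gunit *m t^T *m (map_mx ratr M)^T)]].

End Orbits.
End RealCyclotomic.

Arguments Aplus {F} z.
Arguments ideal_classes {F} z.

Definition is_galois_closure (K : fieldExtType rat) (L : splittingFieldType rat)
    (f : {rmorphism K -> L}) : Prop :=
  galois 1%AS {:L}%AS /\
  forall M : {subfield L},
    (forall x, f x \in M) -> galois 1%AS M -> M = {:L}%AS.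

(* MathComp indexes dihedral groups by their order. *)
Definition Dp_extension (p : nat) (K : fieldExtType rat) : Prop :=
  \dim {:K} = p /\
  exists (L : splittingFieldType rat) (f : {rmorphism K -> L}),
    is_galois_closure f /\
    ('Gal({:L}%AS / 1%AS) \isog finset.setTfor 'D_(p.*2))%g.

Section UnitShape.
Variables (R : realType) (K : fieldExtType rat) (r : nat).
Variables (iota : {rmorphism K -> R}) (tau : 'I_r -> {rmorphism K -> R[i]}).

Definition nonreal (s : K -> R[i]) : Prop := exists x, complex.Im (s x) != 0.

Definition conj_pair (s s' : K -> R[i]) : Prop :=
  s =1 s' \/ s =1 (fun x => conjc (s' x)).

(* iota is the only real embedding of K, and tau picks exactly one embedding
   in each pair of complex conjugate nonreal embeddings. *)
Definition embeddings_spec : Prop :=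
  [/\ forall s : {rmorphism K -> R}, s =1 iota,
      forall k, nonreal (tau k),
      forall k l, conj_pair (tau k) (tau l) -> k = l &
      forall s : {rmorphism K -> R[i]},
        nonreal s -> exists k, conj_pair s (tau k)].

Definition alg_integer (x : K) : Prop := integralOver (intr : int -> K) x.

Definition units_OK : set K :=
  [set u | [/\ u != 0, alg_integer u & alg_integer u^-1]].

Definition Log (u : K) : 'rV[R]_(1 + r) :=
  row_mx (ln `|iota u|)%:M (\row_(k < r) (2 * ln (ComplexField.Normc.normc (tau k u)))).

(* Torsion units have trivial Log, so the image of the group of units is that
   of the quotient by torsion. *)
Definition unit_shape : set 'M[R]_r := lattice_shape (Log @` units_OK).

End UnitShape.

(* Main.v *)
From HB Require Import structures.
Require Import Defs.
From mathcomp Require Import all_boot all_order all_fingroup all_algebra.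
From mathcomp Require Import all_solvable all_field.
From mathcomp Require Import complex ring lra zify.
From mathcomp Require Import all_classical all_reals all_analysis.

Set Implicit Arguments.
Unset Strict Implicit.
Unset Printing Implicit Defensive.

Import Order.TTheory GRing.Theory Num.Theory.
Import numFieldNormedType.Exports.

Local Open Scope classical_set_scope.
Local Open Scope ring_scope.

(** Write Q+ for the real cyclotomic field, A+ for its ring of integers with
    basis B, j_1, ..., j_r for its real embeddings, and P = (j_i (B_k)).

    The orbits. The trace form has Gram matrix G = P P^T, since the trace is
    the sum of the j_i, and the extra column of Gtilde is minus the sum of the
    others. Hence Gunit = (P Q) (P Q)^T with Q = P^T (1 | -1), and the orbit of
    an ideal with basis v consists of the Gram matrices of X t Q, where
    X = (j_i (v_k)) and t runs over the diagonal torus (torus_orbitE).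
    Replacing Q by a square root of Q Q^T displays it as a translate of the
    torus orbit of X. Multiplying an ideal by q multiplies X on the right by
    the diagonal matrix of the j_i q, which the torus absorbs, and a change of
    basis multiplies X on the left by an element of GL_r(Z); so the image in
    the space of shapes depends on the ideal class only.

    Periodicity. A unit u of A+ preserves every ideal, so X diag(j_i u) = U X
    with U in GL_r(Z). By the box principle, A+ has units u such that all
    t_i |j_i u| are bounded, uniformly over all weights t of product 1
    (bounded_units). Every point of the torus orbit is therefore homothetic to
    a point X d with d in a fixed compact subset of the torus.

    The unit lattice. Let sigma be an element of order p of the Galois group
    of the closure of K. Extend the real embedding of K to an embedding psi of
    the closure, and let e_k be the restriction of psi sigma^k to K, for k
    modulo p. Complex conjugation is induced by an involution, which inverts
    sigma, so e_{-k} is conjugate to e_k, and the map T u = sigma(u)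
    sigma^{-1}(u) sends K to itself (dihedral_embeddings). With
    l_k(u) = log |e_k u| one has l_k(T u) = l_{k+1}(u) + l_{k-1}(u), while
    B_1 B_k = B_{k+1} + B_{k-1}; the vector (l_0, 2 l_1, ..., 2 l_r) obeys the
    same linear relations as (B_0, ..., B_r). So it equals
    (sum_i c_i(u) j_i(B_k))_k for a row c(u), called spectral below, and T
    multiplies c_i by j_i(B_1). The vector of logarithms is thus c(u) Q, up to
    a permutation of coordinates.

    It remains to identify the lattice of all c(u). Fix a unit u0 that is
    smaller than 1 in all nonreal embeddings; then every c_i(u0) is positive
    (pisot_unit, spectral_gt0). Let I be the set of x in Q+ such that
    (j_i(x) c_i(u0))_i is some c(u). It is an A+-module. It has bounded
    denominators, because only finitely many vectors c(u) are bounded by a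
    given constant, so that a pigeonhole among the powers of a unit gives the
    multiples (finite_spectral, unit_module_denominator); the same argument
    shows that every c(u) comes from I. Hence I is a fractional ideal, and a
    Z-basis of an ideal in its class gives a Z-basis of the unit lattice whose
    Gram matrix is visibly in the orbit (unit_shape_orbit). *)

(** * Integral bases and the box principle *)

Lemma Zcomb_comp (V : zmodType) (m n : nat) (v : 'I_n -> V)
    (U : 'I_m -> 'I_n -> int) (c : 'I_m -> int) :
  \sum_(k < m) (\sum_(l < n) v l *~ U k l) *~ c k =
  \sum_(l < n) v l *~ (\sum_(k < m) U k l * c k).
Proof.
under eq_bigr do rewrite mulrz_suml.
rewrite exchange_big /=; apply: eq_bigr => l _.
by rewrite mulrz_sumr; apply: eq_bigr => k _; rewrite mulrzA.
Qed.

Lemma Zbasis_mem (V : zmodType) (n : nat) (L : set V) (v : 'I_n -> V) :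
  Zbasis L v -> forall k, L (v k).
Proof.
case=> -> _ k; exists (fun l => (l == k)%:Z) => //.
rewrite (bigD1 k) //= eqxx big1 ?addr0 // => l /negPf ->.
by rewrite mulr0z.
Qed.

Lemma Zbasis_change (V : zmodType) (n : nat) (L : set V) (v v' : 'I_n -> V) :
  Zbasis L v -> Zbasis L v' ->
  exists2 U : 'M[int]_n, U \in unitmx &
    forall k, v' k = \sum_(l < n) v l *~ U k l.
Proof.
move=> bv bv'.
have half (a b : 'I_n -> V) : Zbasis L a -> Zbasis L b ->
    exists U : 'M[int]_n, forall k, b k = \sum_(l < n) a l *~ U k l.
  move=> [La _] /Zbasis_mem bb.
  have : forall k, exists c : 'I_n -> int, b k = \sum_(l < n) a l *~ c l.
    by move=> k; have := bb k; rewrite La => -[c _ <-]; exists c.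
  case/choice=> c cP; exists (\matrix_(k, l) c k l) => k.
  by rewrite cP; apply: eq_bigr => l _; rewrite mxE.
have [U UP] := half _ _ bv bv'; have [W WP] := half _ _ bv' bv.
exists U => //; suff /mulmx1_unit[] : W *m U = 1%:M by [].
apply/matrixP => k l; rewrite !mxE.
suff : \sum_j W k j * U j l - (k == l)%:R = 0 by move/eqP; rewrite subr_eq0 => /eqP.
case: bv => _ /(_ (fun l => \sum_j W k j * U j l - (k == l)%:R)); apply.
under eq_bigr do rewrite mulrzBr.
rewrite sumrB; apply/eqP; rewrite subr_eq0; apply/eqP.
transitivity (v k).
  rewrite (WP k); under [RHS]eq_bigr do rewrite UP.
  rewrite Zcomb_comp; apply: eq_bigr => i _; congr (_ *~ _).
  by apply: eq_bigr => h _; rewrite mulrC.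
rewrite (bigD1 k) //= eqxx big1 ?addr0 // => i /negPf; rewrite eq_sym => ->.
by rewrite mulr0z.
Qed.

Lemma pigeonhole (A B : finType) (f : A -> B) : (#|B| < #|A|)%N ->
  exists x y, x != y /\ f x = f y.
Proof.
move=> lt; have /injectivePn[x [y ne e]] : ~~ injectiveb f.
  by apply/negP => /injectiveP/leq_card; rewrite leqNgt lt.
by exists x, y.
Qed.

(** Dirichlet's box principle. The bound H depends on A only, not on the
    weights: cutting the range of the i-th form into about t_i b pieces gives
    at most b^n cells for the (b + 1)^n vectors with entries in [0, b]. *)
Lemma small_integer_vector (R : realType) (n : nat) (A : 'M[R]_n) : (0 < n)%N ->
  exists2 H : R, 0 < H & forall t : 'I_n -> R, (forall i, 0 < t i) ->
    \prod_i t i = 1 ->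
    exists2 c : 'rV[int]_n, c != 0 &
      forall i, t i * `|(map_mx intr c *m A) 0 i| <= H.
Proof.
move=> n0; pose h : R := 1 + \sum_k \sum_i `|A k i|.
have h0 : 0 < h by rewrite ltr_pwDl // sumr_ge0 // => k _; rewrite sumr_ge0.
exists (4 * h); first by rewrite mulr_gt0.
move=> t t0 t1.
(* b is so large that every range is cut into at least one piece. *)
pose b : nat := (Num.truncn (\sum_i (t i)^-1)).+1.
have bP i : 1 <= t i * b%:R.
  rewrite -ler_pdivrMl // mulr1 ltW //; apply: le_lt_trans (truncnS_gt _).
  by rewrite (bigD1 i) //= lerDl sumr_ge0 // => k _; rewrite invr_ge0 ltW.
have b0 : 0 < b%:R :> R by rewrite ltr0n.
pose m i : nat := (Num.truncn (t i * b%:R)).-1.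
have mE i : (m i).+1 = Num.truncn (t i * b%:R).
  by rewrite /m prednK // truncn_gt0.
have mle i : (m i).+1%:R <= t i * b%:R.
  by rewrite mE truncn_le // ltW // mulr_gt0.
have mgt i : t i * b%:R < 2 * (m i).+1%:R.
  have : t i * b%:R < (m i).+2%:R by rewrite mE truncnS_gt.
  have : 1 <= (m i).+1%:R :> R by rewrite ler1n.
  by rewrite -[(m i).+2%:R]natr1; lra.
pose L (c : {ffun 'I_n -> 'I_b.+1}) i : R := \sum_k (c k)%:R * A k i.
have L_le c i : `|L c i| < b%:R * h.
  apply: le_lt_trans (ler_norm_sum _ _ _) _.
  rewrite /h mulrDr mulr1 ltr_pwDl // mulr_sumr.
  apply: ler_sum => k _; rewrite normrM (bigD1 i) //= mulrDr.
  rewrite ler_wpDr // ?mulr_ge0 ?sumr_ge0 //.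
  by rewrite ler_wpM2r // normr_nat ler_nat -ltnS ltn_ord.
pose q c i : R := (L c i + b%:R * h) * (m i).+1%:R / (2 * b%:R * h).
have bh : 0 < 2 * b%:R * h by rewrite !mulr_gt0.
have q_ge0 c i : 0 <= q c i.
  have := L_le c i; rewrite ltr_norml => /andP[lo hi].
  by rewrite /q divr_ge0 ?mulr_ge0 ?ltW //; lra.
have q_lt c i : q c i < (m i).+1%:R.
  rewrite /q ltr_pdivrMr // mulrC ltr_pM2l ?ltr0n //.
  have := L_le c i; rewrite ltr_norml => /andP[lo hi]; lra.
pose cell (c : {ffun 'I_n -> 'I_b.+1}) : {dffun forall i, 'I_(m i).+1} :=
  finfun (fun i => inord (Num.truncn (q c i)) : 'I_(m i).+1).
have [|c [c' [cc' E]]] := @pigeonhole _ _ cell.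
  rewrite card_ffun !card_ord card_dep_ffun foldrE big_map big_enum /=.
  under eq_bigr do rewrite card_ord.
  rewrite -(ltr_nat R) natr_prod.
  apply: (@le_lt_trans _ _ (b%:R ^+ n)); last first.
    by rewrite natrX ltrXn2r ?ler0n ?ltr_nat // -lt0n.
  apply: (@le_trans _ _ (\prod_i (t i * b%:R))).
    by apply: ler_prod => i _; rewrite ler0n mle.
  by rewrite big_split /= t1 mul1r prodr_const card_ord.
exists (\row_k ((c k)%:Z - (c' k)%:Z)).
  apply: contra_neq cc' => /rowP c0; apply/ffunP => k; apply/val_inj => /=.
  by have := c0 k; rewrite !mxE => /eqP; rewrite subr_eq0 eqz_nat => /eqP.
move=> i; have -> : (map_mx intr (\row_k ((c k)%:Z - (c' k)%:Z)) *m A) 0 i =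
    L c i - L c' i.
  rewrite mxE -sumrB; apply: eq_bigr => k _.
  by rewrite !mxE rmorphB /= mulrBl.
have tE : Num.truncn (q c i) = Num.truncn (q c' i).
  have := congr1 (fun f : {dffun forall i, 'I_(m i).+1} => val (f i)) E.
  have lt d : (Num.truncn (q d i) < (m i).+1)%N.
    by rewrite -(ltr_nat R) (le_lt_trans _ (q_lt d i)) ?truncn_le ?q_ge0.
  by rewrite !ffunE /= !inordK.
have qq : `|q c i - q c' i| <= 1.
  have := truncn_le (q c i); have := truncn_le (q c' i).
  have := truncnS_gt (q c i); have := truncnS_gt (q c' i).
  rewrite !q_ge0 tE -natr1 ler_norml => *; apply/andP; split; lra.
have -> : L c i - L c' i = (q c i - q c' i) * (2 * b%:R * h) / (m i).+1%:R.
  by rewrite /q; field; rewrite ?lt0r_neq0 //= pnatr_eq0.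
rewrite 2!normrM normfV normr_nat (gtr0_norm bh).
rewrite mulrA ler_pdivrMr ?ltr0n //.
have t2 : t i * (2 * b%:R * h) <= 4 * h * (m i).+1%:R.
  have := mgt i; rewrite -(ltr_pM2r h0); lra.
apply: le_trans t2; rewrite mulrCA ler_piMl //.
by rewrite ltW // mulr_gt0.
Qed.

(** * Units of an order *)

Local Notation normc := ComplexField.Normc.normc.

(** Two conjugate embeddings are controlled by the two real forms Re + Im and
    Re - Im. Taking Re + Im of each of n embeddings permuted by conjugation
    thus yields n real forms, whatever the signature of the field. *)
Lemma normc_le_split (R : realType) (x : R[i]) :
  normc x <= `|complex.Re x + complex.Im x| + `|complex.Re x - complex.Im x|.
Proof.
case: x => a b /=.
apply: (@le_trans _ _ (`|a| + `|b|)).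
  rewrite -(ger0_norm (addr_ge0 (normr_ge0 a) (normr_ge0 b))) -sqrtr_sqr.
  apply: ler_wsqrtr; rewrite sqrrD !real_normK ?num_real //.
  by rewrite lerD2r lerDl mulrn_wge0 // mulr_ge0.
have : `|a *+ 2| <= `|a + b| + `|a - b|.
  by apply: le_trans (ler_normD _ _); rewrite le_eqVlt; apply/orP; left;
    apply/eqP; congr `|_|; ring.
have : `|b *+ 2| <= `|a + b| + `|a - b|.
  by apply: le_trans (ler_normB _ _); rewrite le_eqVlt; apply/orP; left;
    apply/eqP; congr `|_|; ring.
by rewrite !normrMn; lra.
Qed.

Lemma normc_prod (R : realType) (I : finType) (f : I -> R[i]) :
  normc (\prod_i f i) = \prod_i normc (f i).
Proof.
apply: (big_morph (@ComplexField.Normc.normc R)).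
  exact: ComplexField.Normc.normcM.
exact: ComplexField.Normc.normc1.
Qed.

Lemma normc_ge0 (R : realType) (x : R[i]) : 0 <= normc x.
Proof. by case: x => a b; exact: sqrtr_ge0. Qed.

Lemma ReDIm_sum (R : realType) (I : finType) (c : I -> int) (f : I -> R[i]) :
  let x := \sum_k (c k)%:~R * f k in
  complex.Re x + complex.Im x =
  \sum_k (c k)%:~R * (complex.Re (f k) + complex.Im (f k)).
Proof.
elim/big_rec2: _ => /= [|k y1 y2 _ IH]; first by rewrite addr0.
have -> : ((c k)%:~R : R[i]) = ((c k)%:~R)%:C%C by rewrite rmorph_int.
by rewrite -IH; case: (f k) y2 {IH} => a b [a' b'] /=; ring.
Qed.

Lemma normc_gt0 (R : realType) (x : R[i]) : x != 0 -> 0 < normc x.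
Proof.
move=> x0; rewrite lt_neqAle eq_sym normc_ge0 andbT.
by apply: contra_neq x0; exact: ComplexField.Normc.eq0_normc.
Qed.

Lemma normc_intr (R : realType) (m : int) : normc (m%:~R : R[i]) = `|m|%N%:R.
Proof.
have -> : (m%:~R : R[i]) = (m%:~R)%:C%C by rewrite rmorph_int.
by rewrite /= expr0n /= addr0 sqrtr_sqr -intr_norm -abszE.
Qed.

Section Orders.
Variables (R : realType) (E : fieldType) (n : nat).
Variables (w : 'cV[E]_n) (e : 'I_n -> {rmorphism E -> R[i]}).

Definition emb_mx (m : nat) (v : 'cV[E]_m) : 'M[R[i]]_(m, n) :=
  \matrix_(k, i) e i (v k 0).

Definition emb_row (x : E) : 'rV[R[i]]_n := \row_i e i x.

Lemma emb_mxM (m k : nat) (U : 'M[int]_(m, k)) (v : 'cV[E]_k) :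
  emb_mx (map_mx intr U *m v) = map_mx intr U *m emb_mx v.
Proof.
apply/matrixP => a i; rewrite !mxE rmorph_sum /=; apply: eq_bigr => b _.
by rewrite !mxE rmorphM rmorph_int.
Qed.

Lemma emb_mxZ (m : nat) (x : E) (v : 'cV[E]_m) :
  emb_mx (x *: v) = emb_mx v *m diag_mx (emb_row x).
Proof.
apply/matrixP => a i; rewrite mul_mx_diag !mxE rmorphM.
exact: mulrC.
Qed.

Hypothesis w_unit : emb_mx w \in unitmx.

(** The columns of emb_mx w are common eigenvectors of all multiplication
    matrices, so the determinant of such a matrix is a norm. *)
Lemma det_multiplication (x : E) (U : 'M[int]_n) :
  x *: w = map_mx intr U *m w -> \prod_i e i x = (\det U)%:~R.
Proof.
move=> /(congr1 (@emb_mx n)); rewrite emb_mxZ emb_mxM => /(congr1 determinant).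
rewrite !det_mulmx mulrC => /mulIf; rewrite det_diag det_map_mx.
move=> <-; first by apply: eq_bigr => i _; rewrite mxE.
by rewrite -unitfE -unitmxE.
Qed.

Lemma unit_multiplication_norm (x : E) (U : 'M[int]_n) :
  U \in unitmx -> x *: w = map_mx intr U *m w -> \prod_i normc (e i x) = 1.
Proof.
rewrite unitmxE => uU /det_multiplication xU.
by rewrite -normc_prod xU normc_intr; case/orP: uU => /eqP ->.
Qed.

Hypothesis n_gt0 : (0 < n)%N.
Hypothesis w_closed : forall k, exists S : 'M[int]_n, w k 0 *: w = map_mx intr S *m w.
Variable s : 'I_n -> 'I_n.
Hypothesis e_conj : forall i x, e (s i) x = conjc (e i x).

Let elt (c : 'rV[int]_n) : E := (map_mx intr c *m w) 0 0.

Let elt_mx : exists U : 'rV[int]_n -> 'M[int]_n,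
  forall c, elt c *: w = map_mx intr (U c) *m w.
Proof.
have [S SP] := choice w_closed.
exists (fun c => \sum_k c 0 k *: S k) => c.
rewrite /elt mxE scaler_suml raddf_sum mulmx_suml; apply: eq_bigr => k _.
rewrite mxE -scalerA SP scalemxAl; congr (_ *m _).
by apply/matrixP => a b; rewrite !mxE /= intrM.
Qed.

Let emb_elt c i : e i (elt c) = (map_mx intr c *m emb_mx w) 0 i.
Proof. by rewrite -emb_mxM mxE. Qed.

Let elt_neq0 (c : 'rV[int]_n) : c != 0 -> elt c != 0.
Proof.
apply: contra_neq => c0.
have : map_mx intr c *m emb_mx w = 0 :> 'rV[R[i]]_n.
  by apply/rowP => i; rewrite -emb_elt c0 rmorph0 mxE.
move=> /(congr1 (mulmxr (invmx (emb_mx w)))) /=.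
rewrite mulmxK // mul0mx => /rowP h; apply/rowP => k.
by have := h k; rewrite !mxE => /eqP; rewrite intr_eq0 => /eqP.
Qed.

(** A form of Dirichlet's unit theorem: the units are cobounded among the
    weights of product 1. The box principle produces, for each weight, a
    nonzero lattice element of bounded norm; these
    fall into finitely many classes modulo their norm, and two elements of the
    same class differ by a unit. Dividing by one representative of each class
    keeps the bound. The lattice spanned by w is stable under multiplication
    but need not contain 1; a unit is an element that acts on it through an
    invertible integral matrix. *)
Lemma bounded_units : exists2 M : R, 0 < M &
  forall t : 'I_n -> R, (forall i, 0 < t i) -> (forall i, t (s i) = t i) ->
    \prod_i t i = 1 ->
  exists (u : E) (U : 'M[int]_n), [/\ U \in unitmx, u != 0,
    u *: w = map_mx intr U *m w & forall i, t i * normc (e i u) <= M].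
Proof.
have [H H0 HP] := small_integer_vector
  (\matrix_(k, i) (complex.Re (emb_mx w k i) + complex.Im (emb_mx w k i))) n_gt0.
have [U UP] := elt_mx.
have detU c : \prod_i normc (e i (elt c)) = `|\det (U c)|%N%:R.
  by rewrite -normc_prod (det_multiplication (UP c)) normc_intr.
have det_neq0 (c : 'rV[int]_n) : c != 0 -> \det (U c) != 0.
  move=> /elt_neq0 c0; rewrite -(intr_eq0 R[i]) -(det_multiplication (UP c)).
  by apply/prodf_neq0 => i _; rewrite fmorph_eq0.
pose X := Num.truncn ((2 * H) ^+ n).
pose small (c : 'rV[int]_n) := c != 0 /\ (`|\det (U c)|%N <= X)%N.
have small_elt t : (forall i, 0 < t i) -> (forall i, t (s i) = t i) ->
    \prod_i t i = 1 ->
    exists2 c, small c & forall i, t i * normc (e i (elt c)) <= 2 * H.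
  move=> t0 ts t1; have [c c0 cH] := HP t t0 t1.
  have LE i : (map_mx intr c *m (\matrix_(k, i) (complex.Re (emb_mx w k i) +
      complex.Im (emb_mx w k i)))) 0 i =
      complex.Re (e i (elt c)) + complex.Im (e i (elt c)).
    rewrite emb_elt !mxE.
    under eq_bigr do rewrite !mxE.
    under [in X in complex.Re X]eq_bigr do rewrite !mxE.
    under [in X in complex.Im X]eq_bigr do rewrite !mxE.
    by rewrite ReDIm_sum.
  have bound i : t i * normc (e i (elt c)) <= 2 * H.
    have := cH i; have := cH (s i); rewrite !LE e_conj ts.
    move: (normc_le_split (e i (elt c))) (t0 i).
    case: (e i _) => a b /= ab ti h1 h2.
    apply: (@le_trans _ _ (t i * (`|a + b| + `|a - b|))).
      by rewrite ler_pM2l.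
    by rewrite mulrDr; lra.
  exists c => //; split=> //.
  rewrite /X truncn_ge_nat ?exprn_ge0 ?mulr_ge0 ?(ltW H0) //.
  have -> : `|\det (U c)|%N%:R = \prod_i (t i * normc (e i (elt c))).
    by rewrite big_split /= t1 mul1r detU.
  rewrite -[X in _ <= _ ^+ X](card_ord n) -prodr_const.
  by apply: ler_prod => i _; rewrite bound mulr_ge0 ?normc_ge0 // ltW.
(* If D is the norm of elt c', then D / elt c' acts integrally, by an adjugate
   matrix; so does the ratio, which is 1 + (D / elt c') * d. *)
have ratio (c c' : 'rV[int]_n) : c' != 0 -> (forall k, (\det (U c') %| (c 0 k - c' 0 k)%R)%Z) ->
    exists W : 'M[int]_n, (elt c / elt c') *: w = map_mx intr W *m w.
  move=> c0 cc'; have /choice[d dP] := fun k => dvdzP (cc' k).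
  set D := \det (U c') in dP.
  have cE : elt c = elt c' + D%:~R * elt (\row_k d k).
    have -> : c = c' + D *: \row_k d k.
      by apply/rowP => k; rewrite !mxE mulrC -dP addrC subrK.
    rewrite /elt map_mxD mulmxDl mxE; congr (_ + _).
    by rewrite map_mxZ -scalemxAl mxE.
  have adjE : D%:~R *: w = elt c' *: (map_mx intr (\adj (U c')) *m w).
    rewrite scalemxAr UP mulmxA -map_mxM mul_adj_mx map_scalar_mx.
    by rewrite mul_scalar_mx.
  exists (1%:M + \adj (U c') *m U (\row_k d k)).
  have c'0 := elt_neq0 c0.
  rewrite cE mulrDl divff // scalerDl scale1r map_mxD mulmxDl map_mx1 mul1mx.
  congr (_ + _); rewrite map_mxM -mulmxA -UP -scalemxAr.
  apply: (scalerI c'0).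
  rewrite [RHS]scalerA [in RHS]mulrC -[RHS]scalerA -adjE !scalerA; congr (_ *: _).
  by field.
pose cls (c : 'rV[int]_n) : 'I_X.+1 * {ffun 'I_n -> 'I_X.+1} :=
  (inord `|\det (U c)|, [ffun k => inord `|(c 0%R k %% \det (U c))%Z|]).
have clsP (c c' : 'rV[int]_n) : small c -> small c' -> cls c = cls c' ->
    forall k, (\det (U c) %| (c' 0 k - c 0 k)%R)%Z.
  move=> sc sc' [/(congr1 val) /= + /ffunP ffE] k.
  rewrite !inordK ?ltnS //; [|by case: sc'|by case: sc].
  move=> absE.
  have modE (d : 'rV[int]_n) : small d ->
      (`|(d 0%R k %% \det (U d))%Z| < X.+1)%N.
    move=> [/det_neq0 d0 dX]; have := ltz_mod (d 0 k) d0.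
    have := modz_ge0 (d 0 k) d0; lia.
  have := congr1 val (ffE k); rewrite !ffunE /= !inordK ?modE //.
  have d0 := det_neq0 _ sc.1; have d0' := det_neq0 _ sc'.1.
  have -> : (c' 0%R k %% \det (U c'))%Z = (c' 0%R k %% \det (U c))%Z.
    by rewrite -modz_abs -absE modz_abs.
  move=> kE; rewrite -eqz_mod_dvd.
  have := modz_ge0 (c 0 k) d0; have := modz_ge0 (c' 0 k) d0; lia.
have /choice[h hP] : forall a, exists c', (exists2 c, small c & cls c = a) ->
    small c' /\ cls c' = a.
  move=> a; have [[c sc ca]|no] := pselect (exists2 c, small c & cls c = a).
    by exists c.
  by exists 0.
pose M0 : R := 1 + \sum_a \sum_i (normc (e i (elt (h a))))^-1.
have M0gt : 0 < M0.
  rewrite ltr_pwDl // sumr_ge0 // => a _; rewrite sumr_ge0 // => i _.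
  by rewrite invr_ge0 normc_ge0.
have M0P a i : (normc (e i (elt (h a))))^-1 <= M0.
  apply: (@le_trans _ _ (\sum_i (normc (e i (elt (h a))))^-1)).
    by rewrite (bigD1 i) //= lerDl sumr_ge0 // => k _; rewrite invr_ge0 normc_ge0.
  rewrite /M0 (bigD1 a) //= addrCA lerDl addr_ge0 // sumr_ge0 // => b _.
  by rewrite sumr_ge0 // => k _; rewrite invr_ge0 normc_ge0.
exists (2 * H * M0); first by rewrite !mulr_gt0.
move=> t t0 ts t1; have [c sc cH] := small_elt t t0 ts t1.
have [sc' cc'] := hP (cls c) (ex_intro2 _ _ c sc erefl).
set c' := h (cls c) in sc' cc'.
have [W WP] := ratio c c' sc'.1 (clsP _ _ sc' sc cc').
have [W' WP'] := ratio c' c sc.1 (clsP _ _ sc sc' (esym cc')).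
have c0 := elt_neq0 sc.1; have c'0 := elt_neq0 sc'.1.
have u0 : elt c / elt c' != 0 by rewrite mulf_neq0 ?invr_eq0.
exists (elt c / elt c'), W; split=> // [|i].
  have : \det W * \det W' = 1.
    apply/eqP; rewrite -(eqr_int R[i]) intrM.
    rewrite -(det_multiplication WP) -(det_multiplication WP').
    rewrite -big_split /= big1 // => i _; rewrite -rmorphM.
    by rewrite mulrA divfK // divff // rmorph1.
  by rewrite unitmxE => dW; apply/unitrP; exists (\det W'); rewrite mulrC dW.
rewrite fmorph_div ComplexField.Normc.normcM ComplexField.Normc.normcV mulrA.
apply: ler_pM (cH i) (M0P (cls c) i); last by rewrite invr_ge0 normc_ge0.
by rewrite mulr_ge0 ?normc_ge0 // ltW.
Qed.
End Orders.

(** * The ring A+ and its basis *)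

Lemma prim_root_neq0 (C : fieldType) (n : nat) (x : C) :
  n.-primitive_root x -> x != 0.
Proof.
move=> x_prim; apply: contra_eq_neq (prim_expr_order x_prim) => ->.
by rewrite expr0n gtn_eqF ?(prim_order_gt0 x_prim) // eq_sym oner_neq0.
Qed.

Lemma inv_power_pair_mul (C : fieldType) (x : C) (k : nat) : x != 0 ->
  (x + x^-1) * (x ^+ k.+1 + x ^- k.+1) =
  (x ^+ k.+2 + x ^- k.+2) + (x ^+ k + x ^- k).
Proof.
move=> x0; rewrite -!exprVn !exprS; have : x * x^-1 = 1 by exact: divff.
move: (x^-1) => y xy; rewrite [LHS](_ : _ =
  x * (x * x ^+ k) + y * (y * y ^+ k) + (x * y) * (x ^+ k + y ^+ k)).
  by rewrite xy mul1r.
by ring.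
Qed.

(** Multiplication by x - 1 telescopes the sum to x^(r+1) - x^(-r). *)
Lemma sum_inv_power_pair (C : fieldType) (x : C) (r : nat) :
  x != 1 -> x ^+ r.*2.+1 = 1 -> \sum_(k < r) (x ^+ k.+1 + x ^- k.+1) = -1.
Proof.
move=> x1 xp.
have x0 : x != 0.
  by apply: contra_eq_neq xp => ->; rewrite expr0n eq_sym oner_neq0.
have key : (x - 1) * (1 + \sum_(k < r) (x ^+ k.+1 + x ^- k.+1)) = x ^+ r.+1 - x ^- r.
  elim: (r) => [|n IH].
    by rewrite big_ord0 addr0 mulr1 expr1 expr0 invr1.
  rewrite big_ord_recr /= addrA mulrDr IH -!exprVn !exprS.
  have : x * x^-1 = 1 by exact: divff.
  move: (x^-1) => y xy; rewrite [LHS](_ : _ =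
    x * (x * x ^+ n) - y * y ^+ n + (x * y - 1) * y ^+ n).
    by rewrite xy subrr mul0r addr0.
  by ring.
have /eqP : (x - 1) * (1 + \sum_(k < r) (x ^+ k.+1 + x ^- k.+1)) = 0.
  rewrite key; apply/eqP; rewrite subr_eq0; apply/eqP.
  apply: (mulIf (expf_neq0 r x0)).
  by rewrite -exprD mulVf ?expf_neq0 // addSn addnn xp.
by rewrite mulf_eq0 subr_eq0 (negPf x1) /= addrC addr_eq0 => /eqP.
Qed.

Section RealCyclotomicField.
Variables p r : nat.
Hypotheses (p_prime : prime p) (p_ge5 : (5 <= p)%N) (r_def : r = ((p - 1) %/ 2)%N).

Lemma p_eq : p = r.*2.+1.
Proof.
have [p2|op] := even_prime p_prime; first by move: p_ge5; rewrite p2.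
by have := odd_double_half p; rewrite op; lia.
Qed.

Lemma r_gt1 : (1 < r)%N.
Proof. by have := p_eq; lia. Qed.

Variables (F : fieldExtType rat) (z : F) (z_prim : p.-primitive_root z).

Local Notation B := (Bplus z).

Let z_neq0 : z != 0 := prim_root_neq0 z_prim.

Let vsval_inj : injective (vsval : Qplus z -> F).
Proof. exact: val_inj. Qed.

Let valB k : vsval (B k) = if k == 0%N then 1 else z ^+ k + z ^- k.
Proof. exact: Bplus_val. Qed.

Lemma B0 : B 0 = 1.
Proof. by apply: vsval_inj; rewrite valB rmorph1. Qed.

Lemma B1_mul1 : B 1 * B 1 = B 2 + 2 * B 0.
Proof.
apply: vsval_inj.
rewrite rmorphM rmorphD rmorphM rmorph_nat /= !valB /= expr1.
have := inv_power_pair_mul 0 z_neq0; rewrite !expr1 => ->.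
by rewrite expr0 invr1 mulr1.
Qed.

Lemma B1_mulSS k : B 1 * B k.+2 = B k.+3 + B k.+1.
Proof.
apply: vsval_inj.
rewrite rmorphM rmorphD /= !valB /= expr1.
exact: inv_power_pair_mul.
Qed.

Lemma sumB : \sum_(k < r.+1) B k = 0.
Proof.
apply: vsval_inj; rewrite rmorph_sum /=.
rewrite big_ord_recl valB /= (eq_bigr (fun k : 'I_r => z ^+ k.+1 + z ^- k.+1)).
  rewrite sum_inv_power_pair ?subrr -?p_eq ?(prim_expr_order z_prim) //.
  rewrite -(expr1 z) -(prim_order_dvd z_prim) gtnNdvd //; lia.
by move=> k _; rewrite valB.
Qed.

(** The relation B_1 B_k = B_{k+1} + B_{k-1} leaves the span only for
    k = r - 1, where sumB expresses B_r by the others. *)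
Lemma B1_mul (k : 'I_r) : exists c : 'I_r -> int, B 1 * B k = \sum_(l < r) B l *~ c l.
Proof.
have one (m : 'I_r) : \sum_(l < r) B l *~ (l == m)%:Z = B m.
  rewrite (bigD1 m) //= eqxx big1 ?addr0 // => l /negPf ->.
  by rewrite mulr0z.
have [lt|ge] := ltnP k.+1 r.
  case: k lt => -[|[|k]] kr lt.
  - by exists (fun l => (l == Ordinal lt)%:Z); rewrite one /= B0 mulr1.
  - exists (fun l => (l == Ordinal lt)%:Z + 2 * (l == Ordinal (ltnW kr))%:Z).
    under eq_bigr do rewrite mulrzDr -mulrzA_C.
    rewrite big_split /= -mulrz_suml !one /= B1_mul1.
    by congr (_ + _); rewrite -mulrzl.
  - exists (fun l => (l == Ordinal lt)%:Z + (l == Ordinal (ltnW kr))%:Z).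
    under eq_bigr do rewrite mulrzDr.
    by rewrite big_split /= !one /= B1_mulSS.
have kE : (k : nat) = r.-1 by have := ltn_ord k; lia.
have Br : B r = \sum_(l < r) B l *~ -1.
  have := sumB; rewrite big_ord_recr /= addrC => /eqP; rewrite addr_eq0 => /eqP ->.
  by rewrite -mulrz_suml mulrN1z.
have [r2|r2] := eqVneq r 2%N.
  exists (fun l => -1 + 2 * (l == Ordinal (ltnW r_gt1))%:Z).
  under eq_bigr do rewrite mulrzDr -mulrzA_C.
  rewrite big_split /= -Br -mulrz_suml one kE.
  have -> : B r = B 2 by rewrite r2.
  have -> : r.-1 = 1%N by rewrite r2.
  rewrite B1_mul1.
  by congr (_ + _); rewrite -mulrzl.
have lt : (r.-2 < r)%N by have := r_gt1; lia.
exists (fun l => -1 + (l == Ordinal lt)%:Z).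
under eq_bigr do rewrite mulrzDr.
rewrite big_split /= -Br one kE /=.
have e0 : (r - 3).+2 = r.-1 by have := r_gt1; lia.
have e1 : (r - 3).+3 = r by have := r_gt1; lia.
have e2 : (r - 3).+1 = r.-2 by have := r_gt1; lia.
by have := B1_mulSS (r - 3); rewrite e1 e0 e2.
Qed.

Lemma mem_Aplus_B k : Aplus z (B k).
Proof.
suff : Aplus z (B k) /\ Aplus z (B k.+1) by case.
elim: k => [|k [[q _ qk] [q' _ qk']]].
  split; first by exists 1; rewrite // rmorph1 hornerC B0.
  by exists 'X; rewrite // map_polyX hornerX.
split; first by exists q'.
case: k qk qk' => [|k] qk qk'.
  exists ('X ^+ 2 - 2) => //.
  rewrite rmorphB rmorphXn rmorph_nat /= map_polyX !hornerE.
  rewrite -[RHS](addrK (2 * B 0)) -B1_mul1 B0.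
  by rewrite expr2 mulr1.
exists ('X * q' - q) => //.
rewrite rmorphB rmorphM /= map_polyX !hornerE /= qk qk' B1_mulSS.
by rewrite addrK.
Qed.

Lemma AplusD x y : Aplus z x -> Aplus z y -> Aplus z (x + y).
Proof. by case=> q _ <- [q' _ <-]; exists (q + q'); rewrite // rmorphD hornerD. Qed.

Lemma AplusM x y : Aplus z x -> Aplus z y -> Aplus z (x * y).
Proof. by case=> q _ <- [q' _ <-]; exists (q * q'); rewrite // rmorphM hornerM. Qed.

Lemma AplusMz x m : Aplus z x -> Aplus z (x *~ m).
Proof.
rewrite -mulrzl => Ax; apply: AplusM => //.
by exists m%:P; rewrite // map_polyC hornerC.
Qed.

Lemma Aplus_sum (c : 'I_r -> int) : Aplus z (\sum_(k < r) B k *~ c k).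
Proof.
elim/big_rec: _ => [|k x _ Ax]; first by exists 0; rewrite // rmorph0 horner0.
by apply: AplusD => //; apply/AplusMz/mem_Aplus_B.
Qed.

(** The powers of B_1 stay in the span of B_0, ..., B_{r-1} by B1_mul. *)
Lemma AplusP x : Aplus z x <-> exists c : 'I_r -> int, x = \sum_(k < r) B k *~ c k.
Proof.
split=> [[q _ <-]|[c ->]]; last exact: Aplus_sum.
elim/poly_ind: q => [|q a [c qE]].
  exists (fun=> 0); rewrite rmorph0 horner0 big1 // => k _.
have [S SP] := choice B1_mul.
exists (fun l => \sum_k S k l * c k + a * (l == 0%N :> nat)%:Z).
rewrite rmorphD rmorphM /= map_polyX map_polyC /= hornerMXaddC qE.
under [RHS]eq_bigr do rewrite mulrzDr.
rewrite big_split /=; congr (_ + _).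
  rewrite -Zcomb_comp mulr_suml; apply: eq_bigr => k _.
  by rewrite -SP mulrzAl mulrC.
rewrite (bigD1 (Ordinal (ltnW r_gt1))) //= mulr1 B0 big1 ?addr0 // => l l0.
have -> : (l == 0%N :> nat) = false by apply: contra_neqF l0 => /eqP l0; apply/val_inj.
by rewrite mulr0 mulr0z.
Qed.

(** Same induction as AplusP, with rational coefficients. *)
Lemma Qplus_rat_comb (x : Qplus z) : exists c : 'I_r -> rat, x = \sum_(k < r) c k *: B k.
Proof.
have [q ->] : exists q : {poly rat}, x = (map_poly (in_alg (Qplus z)) q).[B 1].
  have /Fadjoin_polyP[_ /polyOver1P[q ->] xq] := valP x.
  exists q; apply: vsval_inj; rewrite xq.
  rewrite -horner_map /= -map_poly_comp valB /= expr1; congr (_.[_]).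
  by apply: eq_map_poly => a; rewrite -[RHS]/(vsval (a *: 1)) linearZ rmorph1.
elim/poly_ind: q => [|q a [c qE]].
  exists (fun=> 0); rewrite rmorph0 horner0 big1 // => k _.
  by rewrite scale0r.
have [S SP] := choice B1_mul.
exists (fun l => \sum_k c k * (S k l)%:~R + a * (l == 0%N :> nat)%:R).
rewrite rmorphD rmorphM /= map_polyX map_polyC /= hornerMXaddC qE.
under [RHS]eq_bigr do rewrite scalerDl scaler_suml.
rewrite big_split /=; congr (_ + _).
  rewrite exchange_big mulr_suml /=; apply: eq_bigr => k _.
  rewrite -scalerAl mulrC SP scaler_sumr; apply: eq_bigr => l _.
  by rewrite -scalerA scaler_int.
rewrite (bigD1 (Ordinal (ltnW r_gt1))) //= mulr1 B0 big1 ?addr0 // => l l0.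
have -> : (l == 0%N :> nat) = false by apply: contra_neqF l0 => /eqP l0; apply/val_inj.
by rewrite mulr0 scale0r.
Qed.

End RealCyclotomicField.

(** * The torus orbits as explicit families of Gram matrices *)

Lemma rmorph_ratZ (E : fieldExtType rat) (C : numFieldType)
    (f : {rmorphism E -> C}) (a : rat) (x : E) : f (a *: x) = ratr a * f x.
Proof.
rewrite -mulr_algl rmorphM; congr (_ * _).
exact: (fmorph_eq_rat (f \o in_alg E : {rmorphism rat -> C})).
Qed.

(** The weight of 0 accounts for B_0 being 1 instead of 2, the value at k = 0 of
    y^k + y^-k: with f k a product of two conjugates of B_k, either side is half
    of a sum over Z/p. *)
Lemma weighted_sum (R : realType) (f : nat -> R) (n : nat) : (0 < n)%N ->
  \sum_(k < n) (1 + (k == 0%N :> nat)%:R) * f k + f n =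
  2 * f 0%N + \sum_(k < n) f k.+1.
Proof.
case: n => // n _; rewrite big_ord_recl [in RHS]big_ord_recr /= addrA.
congr (_ + _ + _); apply: eq_bigr => k _.
by rewrite addr0 mul1r.
Qed.

Section TorusOrbits.
Variables (R : realType) (p r : nat).
Hypotheses (p_prime : prime p) (p_ge5 : (5 <= p)%N) (r_def : r = ((p - 1) %/ 2)%N).
Variables (F : fieldExtType rat) (z : F) (z_prim : p.-primitive_root z).
Variables (phi : {rmorphism F -> R[i]}) (j : 'I_r -> {rmorphism Qplus z -> R}).
Hypothesis j_spec : forall i : 'I_r,
  real_complex R (j i (Bplus z 1)) = phi z ^+ i.+1 + phi z ^- i.+1.

Local Notation B := (Bplus z).
Local Notation P := (Pmx j).

Let pE : p = r.*2.+1 := p_eq p_prime p_ge5 r_def.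
Let r1 : (1 < r)%N := r_gt1 p_prime p_ge5 r_def.

Let phi_prim : p.-primitive_root (phi z).
Proof. by rewrite fmorph_primitive_root. Qed.

Let phi_neq0 : phi z != 0 := prim_root_neq0 phi_prim.

Lemma j_B i k : real_complex R (j i (B k)) =
  if k == 0%N then 1 else (phi z ^+ i.+1) ^+ k + (phi z ^+ i.+1) ^- k.
Proof.
have y0 : phi z ^+ i.+1 != 0 by rewrite expf_neq0.
move: (j_spec i) y0; move: (phi z ^+ i.+1) => y jy y0.
have j0 : j i (B 0) = 1 by rewrite (B0 z_prim) rmorph1.
case: k => [|k] /=; first by rewrite j0.
suff : real_complex R (j i (B k.+1)) = y ^+ k.+1 + y ^- k.+1 /\
       real_complex R (j i (B k.+2)) = y ^+ k.+2 + y ^- k.+2 by case.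
elim: k => [|k [IH1 IH2]].
  split; first by rewrite expr1.
  have := B1_mul1 z_prim => /(congr1 (real_complex R \o j i)) /=.
  rewrite !(rmorphM, rmorphD, rmorph_nat) /= jy j0 rmorph1 mulr1.
  have := inv_power_pair_mul 0 y0; rewrite !expr1 expr0 invr1 => -> /esym.
  exact: addIr.
split => //.
have := B1_mulSS z_prim k => /(congr1 (real_complex R \o j i)) /=.
rewrite !(rmorphM, rmorphD) /= jy IH2 IH1.
by have := inv_power_pair_mul k.+1 y0 => -> /esym; exact: addIr.
Qed.

(** Orthogonality of the cosines: B_k(i) B_k(l) = B_k(i + l) + B_k(i - l), and
    the sum of B_k(m) over 1 <= k <= r is -1 unless p divides m. *)
Lemma orthogonality (i l : 'I_r) :
  \sum_(k < r) (1 + (k == 0%N :> nat)%:R) * (j i (B k) * j l (B k)) +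
    j i (B r) * j l (B r) = (i == l)%:R * p%:R.
Proof.
rewrite (weighted_sum (fun k => j i (B k) * j l (B k)) (ltnW r1)); apply: complexI.
rewrite rmorphD !rmorphM rmorph_sum /= !j_B /= !mulr1 !rmorph_nat.
pose a := phi z ^+ i.+1; pose b := phi z ^+ l.+1.
have a0 : a != 0 by rewrite expf_neq0.
have b0 : b != 0 by rewrite expf_neq0.
have ap : a ^+ p = 1 by rewrite exprAC (prim_expr_order phi_prim) expr1n.
have bp : b ^+ p = 1 by rewrite exprAC (prim_expr_order phi_prim) expr1n.
under eq_bigr => k _.
  rewrite rmorphM /= !j_B /= -/a -/b.
  have -> : (a ^+ k.+1 + a ^- k.+1) * (b ^+ k.+1 + b ^- k.+1) =
    ((a * b) ^+ k.+1 + (a * b) ^- k.+1) + ((a / b) ^+ k.+1 + (a / b) ^- k.+1).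
    rewrite !exprMn !exprVn; field.
    by rewrite !expf_neq0.
  over.
rewrite big_split /= sum_inv_power_pair; last by rewrite -pE exprMn ap bp mulr1.
  have [il|il] := eqVneq i l.
    have -> : b = a by rewrite /b -il.
    rewrite divff //; under eq_bigr do rewrite !expr1n invr1.
    by rewrite sumr_const card_ord mul1r pE -[r.*2.+1]addn1 -addnn !natrD -mulr_natr; ring.
  rewrite sum_inv_power_pair.
  - by rewrite mul0r; ring.
  - apply: contra_neq il => /(congr1 (fun x => x * b)); rewrite divfK // mul1r.
    move/eqP; rewrite /a /b (eq_prim_root_expr phi_prim) !modn_small.
    + by move=> /eqP[] /val_inj.
    + by have := ltn_ord l; lia.
    + by have := ltn_ord i; lia.
  - by rewrite -pE exprMn exprVn ap bp invr1 mulr1.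
rewrite -exprD -(prim_order_dvd phi_prim) gtnNdvd //.
by have := ltn_ord l; have := ltn_ord i; lia.
Qed.

Lemma j_Br i : j i (B r) = - \sum_(k < r) j i (B k).
Proof.
have := sumB p_prime p_ge5 r_def z_prim => /(congr1 (j i)).
rewrite rmorph_sum rmorph0 /= big_ord_recr /= => /eqP.
by rewrite addrC addr_eq0 => /eqP.
Qed.

(** Eliminating B_r from the orthogonality relations leaves an inverse of P^T,
    up to the factor p. *)
Lemma Pmx_unit : P \in unitmx.
Proof.
pose Y : 'M[R]_r := \matrix_(k, l)
  ((1 + (k == 0%N :> nat)%:R) * j l (B k) - j l (B r)).
have PY : P^T *m Y = p%:R%:M.
  apply/matrixP => i l; rewrite !mxE -[RHS]mulr_natl.
  rewrite -orthogonality [j i (B r)]j_Br mulNr mulr_suml -sumrB.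
  by apply: eq_bigr => k _; rewrite !mxE; ring.
have p0 : p%:R != 0 :> R by rewrite pnatr_eq0; lia.
rewrite -unitmx_tr.
suff /mulmx1_unit[] : P^T *m (p%:R^-1 *: Y) = 1%:M by [].
by rewrite -scalemxAr PY scale_scalar_mx mulVf.
Qed.

(** Its rows are a basis of the sum-zero hyperplane of R^(r+1), where
    logarithms of units live. *)
Definition hyp_mx : 'M[R]_(r, r + 1) := row_mx 1%:M (\col__ -1).

(** By the relation among the B_k, this is the r x (r+1) matrix of all
    j_i (B_k) with 0 <= k <= r. *)
Definition Qmx : 'M[R]_(r, r + 1) := P^T *m hyp_mx.

Definition real_mx (n : nat) (v : 'I_n -> Qplus z) : 'M[R]_(n, r) :=
  \matrix_(k, i) j i (v k).

(** In the basis B the matrix of multiplication by x is P diag(j_i x) P^-1; the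
    two rational matrices S1 and S2 change from B to the basis that defines
    the trace. *)
Lemma trace_sum (x : Qplus z) : ratr (Qplus_trace x) = \sum_i j i x.
Proof.
pose e := vbasis {:Qplus z}.
have eP : basis_of {:Qplus z} e by exact: vbasisP.
set N := passmx.mxof e e (amull x).
have NE k : x * e`_k = \sum_l coord e l (x * e`_k) *: e`_l.
  by rewrite [LHS](coord_basis eP) // memvf.
have [S SP] := choice (fun k : 'I_(\dim {:Qplus z}) =>
  Qplus_rat_comb p_prime p_ge5 r_def z_prim e`_k).
pose V : 'M[R]_(_, r) := \matrix_(k < \dim {:Qplus z}, i < r) j i e`_k.
pose S1 : 'M[rat]_(_, r) := \matrix_(k < \dim {:Qplus z}, l < r) S k l.
pose S2 : 'M[rat]_(r, _) := \matrix_(l < r, k < \dim {:Qplus z}) coord e k (B l).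
have S12 : S1 *m S2 = 1%:M.
  apply/matrixP => k m; rewrite !mxE.
  rewrite -(coord_free k m (basis_free eP)) SP linear_sum /=.
  by apply: eq_bigr => l _; rewrite !mxE linearZ.
have S2V : map_mx ratr S2 *m V = P.
  apply/matrixP => l i; rewrite !mxE.
  rewrite [B l](coord_basis eP) ?memvf // rmorph_sum.
  by apply: eq_bigr => k _; rewrite !mxE /= rmorph_ratZ.
have S1P : map_mx ratr S1 *m P = V.
  apply/matrixP => k i; rewrite !mxE SP rmorph_sum.
  by apply: eq_bigr => l _; rewrite !mxE /= rmorph_ratZ.
have NV : map_mx ratr N *m V = V *m diag_mx (\row_i j i x).
  apply/matrixP => k i; rewrite mul_mx_diag !mxE mulrC -rmorphM NE rmorph_sum.
  apply: eq_bigr => l _; rewrite !mxE /= rmorph_ratZ; congr (ratr _ * _).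
  by rewrite passmx.vecof_delta lfunE.
rewrite /Qplus_trace -/e -/N -[N]mulmx1 -S12 mulmxA mxtrace_mulC.
have -> : ratr (\tr (S2 *m (N *m S1))) = \tr (map_mx ratr (S2 *m (N *m S1))) :> R.
  by rewrite -trace_map_mx.
have conjP : map_mx ratr (S2 *m (N *m S1)) *m P = P *m diag_mx (\row_i j i x).
  by rewrite !map_mxM -!mulmxA S1P NV mulmxA S2V.
rewrite -[X in \tr X](mulmxK Pmx_unit) conjP mxtrace_mulC mulmxA mulVmx ?Pmx_unit //.
by rewrite mul1mx mxtrace_diag; apply: eq_bigr => i _; rewrite mxE.
Qed.

Lemma Gtrace_eq : map_mx ratr (Gtrace z r) = P *m P^T.
Proof.
apply/matrixP => k l; rewrite !mxE trace_sum; apply: eq_bigr => i _.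
by rewrite rmorphM !mxE.
Qed.

Lemma Gunit_eq : Gunit z R r = (P *m Qmx) *m (P *m Qmx)^T.
Proof.
rewrite /Gunit map_mxM -map_trmx.
suff -> : map_mx ratr (Gtilde z r) = P *m Qmx by [].
rewrite /Gtilde /Qmx mulmxA -Gtrace_eq map_row_mx mul_mx_row mulmx1.
congr row_mx; apply/colP => k; rewrite !mxE rmorphN rmorph_sum /= -sumrN.
by apply: eq_bigr => i _; rewrite !mxE mulrN1.
Qed.

Lemma coord_mx_real (v : 'I_r -> Qplus z) (M : 'M[rat]_r) :
  is_coord_mx v M -> real_mx v = map_mx ratr M *m P.
Proof.
move=> vM; apply/matrixP => k i; rewrite !mxE vM rmorph_sum /=.
by apply: eq_bigr => l _; rewrite !mxE rmorph_ratZ.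
Qed.

Lemma coord_mx_exists (v : 'I_r -> Qplus z) : exists M, is_coord_mx v M.
Proof.
have [c cP] := choice (fun k => Qplus_rat_comb p_prime p_ge5 r_def z_prim (v k)).
exists (\matrix_(k, l) c k l) => k; rewrite cP.
by apply: eq_bigr => l _; rewrite mxE.
Qed.

(** The outer factors P and P^-1 of the torus Tp cancel against
    Gunit = (P Q) (P Q)^T and against M P = real_mx j v. *)
Lemma torus_orbitE (v : 'I_r -> Qplus z) : torus_orbit j v =
  [set X | exists (c : R) (t : 'M[R]_r), [/\ 0 < c, diag_torus t &
     X = c *: ((real_mx v *m t *m Qmx) *m (real_mx v *m t *m Qmx)^T)]].
Proof.
have key M t : is_coord_mx v M ->
    map_mx ratr M *m (P *m t *m invmx P) *m Gunit z R r *m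
      (P *m t *m invmx P)^T *m (map_mx ratr M)^T =
    (real_mx v *m t *m Qmx) *m (real_mx v *m t *m Qmx)^T.
  move=> /coord_mx_real ->; rewrite Gunit_eq.
  set N := map_mx ratr M.
  have -> : N *m P *m t *m Qmx = N *m (P *m t *m invmx P) *m (P *m Qmx).
    by rewrite !mulmxA mulmxKV ?Pmx_unit.
  by rewrite !trmx_mul !mulmxA.
apply/seteqP; split=> X.
  move=> [M [c [_ [vM c0 [t tT <-] ->]]]]; exists c, t; split=> //.
  by rewrite key.
move=> [c [t [c0 tT ->]]]; have [M vM] := coord_mx_exists v.
exists M, c, (P *m t *m invmx P); split=> //; first by exists t.
by rewrite key.
Qed.

(** Q Q^T = P^T (1 + J) P, where J has all entries 1; and 1 + J is the square
    of 1 + c J, with c the positive root of 2 c + r c^2 = 1. *)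
Lemma Qmx_sqrt : exists2 h : 'M[R]_r, h \in unitmx & Qmx *m Qmx^T = h *m h^T.
Proof.
have r0 : 0 < r%:R :> R by rewrite ltr0n ltnW.
pose c : R := (Num.sqrt (1 + r%:R) - 1) / r%:R.
have cE : c * 2 + c ^+ 2 * r%:R = 1.
  have : Num.sqrt (1 + r%:R) ^+ 2 = 1 + r%:R :> R by rewrite sqr_sqrtr // addr_ge0 // ltW.
  rewrite /c; move: (Num.sqrt _) => s s2.
  have -> : (s - 1) / r%:R * 2 + ((s - 1) / r%:R) ^+ 2 * r%:R = (s ^+ 2 - 1) / r%:R.
    by field; rewrite lt0r_neq0.
  by rewrite s2 addrC addKr divff // lt0r_neq0.
pose J : 'M[R]_r := const_mx 1.
have JJ : J *m J = r%:R *: J.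
  apply/matrixP => k l; rewrite !mxE.
  under eq_bigr do rewrite !mxE mulr1.
  by rewrite sumr_const card_ord mulr1.
have comb a b a' b' : (a%:M + b *: J) *m (a'%:M + b' *: J) =
    (a * a')%:M + (a * b' + b * a' + b * b' * r%:R) *: J.
  rewrite mulmxDl !mulmxDr mul_scalar_mx scale_scalar_mx mul_scalar_mx scalerA.
  rewrite mul_mx_scalar scalerA -scalemxAl -scalemxAr JJ !scalerA -!addrA.
  congr (_ + _); rewrite -!scalerDl; congr (_ *: _); ring.
pose h0 : 'M[R]_r := 1%:M + c *: J.
have h0T : h0^T = h0.
  by apply/matrixP => k l; rewrite !mxE eq_sym.
have h0h0 : h0 *m h0 = 1%:M + 1 *: J.
  by rewrite comb mulr1; congr (_ + _ *: _); rewrite -[RHS]cE; ring.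
have hE : hyp_mx *m hyp_mx^T = 1%:M + 1 *: J.
  rewrite /hyp_mx tr_row_mx mul_row_col trmx1 mulmx1 scale1r; congr (_ + _).
  apply/matrixP => k l; rewrite !mxE big_ord1 !mxE; ring.
have h0u : h0 \in unitmx.
  suff /mulmx1_unit[] : h0 *m (h0 *m (1%:M + (- (1 + r%:R)^-1) *: J)) = 1%:M by [].
  rewrite mulmxA h0h0 comb mulr1.
  rewrite [X in X *: J](_ : _ = 0) ?scale0r ?addr0 //.
  by field; rewrite lt0r_neq0 // addr_gt0.
exists (P^T *m h0); first by rewrite unitmx_mul unitmx_tr Pmx_unit.
rewrite /Qmx !trmx_mul !mulmxA -[_ *m hyp_mx *m _]mulmxA hE.
by rewrite -[_ *m h0 *m _]mulmxA h0T h0h0.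
Qed.

End TorusOrbits.

(** * Ideal classes and periodicity *)

Lemma matrix_entries_continuous (T : topologicalType) (R : realType) (m n : nat)
    (f : T -> 'M[R]_(m, n)) :
  (forall i k, continuous (fun x => f x i k)) -> continuous f.
Proof.
move=> fc x A [V VP VA].
have : \forall y \near x, forall i k, V i k (f y i k).
  apply: filter_forall => i; apply: filter_forall => k.
  exact: (fc i k x) (VP i k).
by apply: filterS => y; exact: VA.
Qed.

Lemma set_val_preimage_compact (T : topologicalType) (A K : set T) :
  K `<=` A -> compact K -> compact [set x : A | K (set_val x)].
Proof.
move=> KA Kc G GF GK.
have /= [|y [Ky ycl]] := Kc (set_val @ G) _; first exact: GK.
have [x xy] : exists x : A, set_val x = y.
  by exists (SigSub (mem_set (KA _ Ky))).
exists x; split; first by rewrite /= xy.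
move=> S V GS [_ [[W oW <-] Wx WV]].
have GvS : G (set_val @^-1` (set_val @` S)) by apply: filterS GS => s Ss; exists s.
have yW : nbhs y W by apply: open_nbhs_nbhs; split=> //; rewrite -xy.
have [_ [[s Ss <-] Ws]] := ycl _ _ GvS yW.
by exists s; split=> //; apply: WV.
Qed.

Lemma shape_class_act (R : realType) (r : nat) (U Y : 'M[R]_r) :
  GLZ U -> shape_class (U *m Y *m U^T) = shape_class Y.
Proof.
move=> UZ; apply/seteqP; split=> X [c [V [c0 VZ ->]]].
  exists c, (V *m U); split=> //; first exact: GLZM.
  by rewrite trmx_mul !mulmxA.
have [W WZ WU] := GLZV UZ; exists c, (V *m W); split=> //; first exact: GLZM.
rewrite trmx_mul !mulmxA; congr (_ *: (_ *m _)).
rewrite -!(mulmxA V) -mulmxA -trmx_mul; congr (_ *m _).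
rewrite -[Y in LHS]mulmx1 -[in LHS](trmx1 R r) -WU trmx_mul !mulmxA WU mul1mx.
by rewrite -!mulmxA -trmx_mul WU trmx1 mulmx1.
Qed.

Lemma map_intr_GLZ (R : realType) (r : nat) (U : 'M[int]_r) :
  U \in unitmx -> @GLZ R r (map_mx intr U).
Proof. by move=> uU; exists U. Qed.

Lemma lattice_shapeE (R : realType) (r n : nat) (L : set 'rV[R]_n) (b : 'M[R]_(r, n)) :
  Zbasis L (fun k => row k b) -> lattice_shape L = shape_class (b *m b^T).
Proof.
move=> Lb; apply/seteqP; split=> [X [b' Lb']|X X_]; last by exists b.
have [U uU UE] := Zbasis_change Lb Lb'.
have -> : b' = map_mx intr U *m b.
  apply/row_matrixP => k; rewrite UE; apply/rowP => i.
  rewrite !mxE summxE; apply: eq_bigr => l _.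
  by rewrite -scaler_int !mxE.
rewrite trmx_mul mulmxA -(mulmxA _ b) shape_class_act //; exact: map_intr_GLZ.
Qed.

Section Ideals.
Variables (F : fieldExtType rat) (z : F) (n : nat).
Implicit Types (L : set (Qplus z)) (v : 'I_n -> Qplus z).

Lemma Zbasis_scale L v q : q != 0 -> Zbasis L v ->
  Zbasis [set q * x | x in L] (fun k => q * v k).
Proof.
move=> q0 [-> free]; split.
  apply/seteqP; split=> [_ [_ [c _ <-] <-]|_ [c _ <-]].
    by exists c; rewrite // mulr_sumr; apply: eq_bigr => k _; rewrite mulrzAr.
  exists (\sum_k v k *~ c k); first by exists c.
  by rewrite mulr_sumr; apply: eq_bigr => k _; rewrite mulrzAr.
move=> c c0; apply: free; apply: (mulfI q0).
by rewrite mulr0 -[RHS]c0 mulr_sumr; apply: eq_bigr => k _; rewrite mulrzAr.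
Qed.

Lemma class_scale C a b : ideal_classes z C -> C a -> C b ->
  exists2 q, q != 0 & a = [set q * y | y in b].
Proof.
move=> [I _ <-] [x x0 ->] [y y0 ->]; exists (x / y).
  by rewrite mulf_neq0 ?invr_eq0.
apply/seteqP; split=> [_ [t It <-]|_ [_ [t It <-] <-]].
  by exists (y * t); [exists t | rewrite mulrA divfK].
by exists t; rewrite // mulrA divfK.
Qed.

Lemma class_stable C a : ideal_classes z C -> C a ->
  (exists2 x, a x & x != 0) /\ forall u x, Aplus z u -> a x -> a (u * x).
Proof.
move=> [I [[y Iy y0] _ I_stable _] <-] [x x0 ->]; split.
  by exists (x * y); [exists y | rewrite mulf_neq0].
move=> u _ Au [t It <-]; exists (u * t); first exact: I_stable.
exact: mulrCA.
Qed.

End Ideals.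

Section PeriodicOrbits.
Variables (R : realType) (p r : nat).
Hypotheses (p_prime : prime p) (p_ge5 : (5 <= p)%N) (r_def : r = ((p - 1) %/ 2)%N).
Variables (F : fieldExtType rat) (z : F) (z_prim : p.-primitive_root z).
Variables (phi : {rmorphism F -> R[i]}) (j : 'I_r -> {rmorphism Qplus z -> R}).
Hypothesis j_spec : forall i : 'I_r,
  real_complex R (j i (Bplus z 1)) = phi z ^+ i.+1 + phi z ^- i.+1.

Local Notation B := (Bplus z).
Local Notation X := (real_mx j).

Let P_unit := Pmx_unit p_prime p_ge5 r_def z_prim j_spec.

Definition emb_diag (x : Qplus z) : 'rV[R]_r := \row_i j i x.

Lemma real_mx_scale n (v : 'I_n -> Qplus z) q :
  X (fun k => q * v k) = X v *m diag_mx (emb_diag q).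
Proof. by apply/matrixP => k i; rewrite mul_mx_diag !mxE rmorphM mulrC. Qed.

Lemma real_mx_comb n m (v : 'I_n -> Qplus z) (v' : 'I_m -> Qplus z)
    (U : 'M[int]_(m, n)) :
  (forall k, v' k = \sum_l v l *~ U k l) -> X v' = map_mx intr U *m X v.
Proof.
move=> v'E; apply/matrixP => k i; rewrite !mxE v'E rmorph_sum.
by apply: eq_bigr => l _; rewrite !mxE /= rmorphMz mulrzl.
Qed.

Lemma diag_torus_mul (d e : 'rV[R]_r) :
  diag_torus (diag_mx d) -> (forall i, e 0 i != 0) ->
  diag_torus (diag_mx e *m diag_mx d).
Proof.
move=> [d' d'0 /matrixP dE] e0; exists (\row_i (e 0 i * d 0 i)).
  move=> i; rewrite mxE mulf_neq0 //.
  by have := dE i i; rewrite !mxE eqxx !mulr1n => <-; exact: d'0.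
apply/matrixP => k l; rewrite mul_diag_mx !mxE.
by case: eqP => [->|_]; rewrite ?mulr1n ?mulr0n ?mulr0.
Qed.

(** Two ideals of one class differ by a factor q, which moves along the torus
    by diag(j_i q), and the bases differ by an element of GL_r(Z). *)
Lemma torus_orbit_image_sub C a b (v w : 'I_r -> Qplus z) :
  ideal_classes z C -> C a -> C b -> Zbasis a v -> Zbasis b w ->
  shape_image (torus_orbit j v) `<=` shape_image (torus_orbit j w).
Proof.
move=> CC Ca Cb av bw.
have [q q0 aE] := class_scale CC Ca Cb.
have := Zbasis_scale q0 bw; rewrite -aE => aqw.
have [U uU /real_mx_comb XU] := Zbasis_change aqw av.
rewrite !(torus_orbitE p_prime p_ge5 r_def z_prim j_spec).
move=> _ [_ [c [t [c0 [d d0 <-] ->]]] <-].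
set N := X w *m (diag_mx (emb_diag q) *m diag_mx d) *m Qmx j.
exists (c *: (N *m N^T)).
  exists c, (diag_mx (emb_diag q) *m diag_mx d); split=> //.
  by apply: diag_torus_mul => [|i]; [exists d | rewrite mxE fmorph_eq0].
rewrite XU real_mx_scale -(shape_class_act _ (map_intr_GLZ R uU)).
congr shape_class; rewrite /N -scalemxAr -scalemxAl; congr (_ *: _).
by rewrite !trmx_mul !mulmxA.
Qed.

(** For x <> 0 in the ideal, the lattice spanned by x B_0, ..., x B_{r-1} is
    contained in the ideal and already has full rank. *)
Lemma real_mx_unit C a (v : 'I_r -> Qplus z) :
  ideal_classes z C -> C a -> Zbasis a v -> X v \in unitmx.
Proof.
move=> CC Ca [aE _]; have [[x ax x0] stab] := class_stable CC Ca.
have : forall k : 'I_r, exists c : 'I_r -> int, x * B k = \sum_l v l *~ c l.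
  move=> k; have : a (B k * x) by apply: stab => //; exact: (mem_Aplus_B z_prim).
  by rewrite aE mulrC => -[c _ <-]; exists c.
case/choice=> c cP.
have : X (fun k : 'I_r => x * B k) \in unitmx.
  rewrite real_mx_scale unitmx_mul; apply/andP; split.
    have -> : X (fun k : 'I_r => B k) = Pmx j by apply/matrixP => k i; rewrite !mxE.
    exact: P_unit.
  rewrite unitmxE det_diag unitfE; apply/prodf_neq0 => i _.
  by rewrite mxE fmorph_eq0.
rewrite (@real_mx_comb _ _ v _ (\matrix_(k, l) c k l)).
  by rewrite unitmx_mul => /andP[].
by move=> k; rewrite cP; apply: eq_bigr => l _; rewrite mxE.
Qed.

Let w : 'cV[Qplus z]_r := \col_k B k.

(** The case of bounded_units where all embeddings are real. The first
    coordinate of u B = U B, where B_0 = 1, shows that u is in A+. *)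
Lemma Aplus_units : exists2 M : R, 0 < M &
  forall t : 'I_r -> R, (forall i, 0 < t i) -> \prod_i t i = 1 ->
  exists u : Qplus z, [/\ u != 0, Aplus z u, Aplus z u^-1,
    \prod_i `|j i u| = 1 & forall i, t i * `|j i u| <= M].
Proof.
pose e i : {rmorphism Qplus z -> R[i]} := real_complex R \o j i.
have eE : emb_mx e w = map_mx (real_complex R) (Pmx j).
  by apply/matrixP => k i; rewrite !mxE.
have wu : emb_mx e w \in unitmx by rewrite eE map_unitmx P_unit.
have normE x i : ComplexField.Normc.normc (e i x) = `|j i x|.
  by rewrite /= expr0n /= addr0 sqrtr_sqr.
have w_mul x : Aplus z x -> exists S : 'M[int]_r, x *: w = map_mx intr S *m w.
  move=> Ax.
  have : forall k : 'I_r, exists c : 'I_r -> int, x * B k = \sum_(l < r) B l *~ c l.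
    move=> k; apply/(AplusP p_prime p_ge5 r_def z_prim)/AplusM => //.
    exact: (mem_Aplus_B z_prim).
  case/choice=> c cP; exists (\matrix_(k, l) c k l).
  apply/colP => k; rewrite !mxE cP; apply: eq_bigr => l _.
  by rewrite !mxE mulrzl.
have mem_A x (S : 'M[int]_r) : x *: w = map_mx intr S *m w -> Aplus z x.
  have r0 : (0 < r)%N by apply: ltnW (r_gt1 p_prime p_ge5 r_def).
  move=> /colP /(_ (Ordinal r0)); rewrite !mxE /= (B0 z_prim) mulr1 => ->.
  apply/(AplusP p_prime p_ge5 r_def z_prim); exists (S (Ordinal r0)).
  by apply: eq_bigr => l _; rewrite !mxE mulrzl.
have [|k|//|M M0 MP] := bounded_units wu _ _ (s := id).
- exact: ltnW (r_gt1 p_prime p_ge5 r_def).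
- by rewrite mxE; apply: w_mul; exact: (mem_Aplus_B z_prim).
- by move=> i x; rewrite conjc_real.
exists M => // t t0 t1; have [//|u [U [uU u0 uw uM]]] := MP t t0 _ t1.
exists u; split=> //.
- exact: mem_A uw.
- apply: (mem_A _ (invmx U)); apply: (scalerI u0); rewrite scalerA divff //.
  by rewrite scale1r scalemxAr uw mulmxA -map_mxM mulVmx // map_mx1 mul1mx.
- by apply: etrans (unit_multiplication_norm wu uU uw); apply: eq_bigr => i _; rewrite normE.
- by move=> i; have := uM i; rewrite normE.
Qed.

(** The compact box m <= |d_i| <= M meets every class of the orbit: the units
    provide the upper bound, and the lower bound follows since the product of
    the |d_i| is 1. *)
Lemma real_mx_periodic C a (v : 'I_r -> Qplus z) :
  ideal_classes z C -> C a -> Zbasis a v -> Defs.periodic (X v).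
Proof.
move=> CC Ca av; have gu := real_mx_unit CC Ca av.
have r0 : (0 < r)%N by apply: ltnW (r_gt1 p_prime p_ge5 r_def).
have [M M0 MP] := Aplus_units.
pose m := (M ^+ r.-1)^-1.
have m0 : 0 < m by rewrite invr_gt0 exprn_gt0.
pose box : set 'rV[R]_r :=
  [set d | forall i, (`[- M, - m]%classic `|` `[m, M]%classic) (d ord0 i)].
have boxP (d : 'rV[R]_r) : box d <-> forall i, m <= `|d 0 i| <= M.
  split=> H i; rewrite /= ?in_itv /=.
    have := H i; rewrite /= !in_itv /=.
    by case=> /andP[h1 h2]; [rewrite ltr0_norm|rewrite gtr0_norm];
      (try apply/andP; try split); lra.
  have [d0|d0] := ltP (d 0 i) 0; [left|right]; apply/andP; move: (H i).
    by rewrite ltr0_norm // => /andP[h1 h2]; split; lra.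
  by rewrite ger0_norm // => /andP[h1 h2]; split.
pose f (d : 'rV[R]_r) := X v *m diag_mx d.
have fc : continuous f.
  apply: matrix_entries_continuous => k i.
  have -> : (fun d => f d k i) = (fun d : 'rV_r => X v k i * d 0 i).
    by apply/funext => d; rewrite /f mul_mx_diag mxE.
  move=> d; have cc := @coord_continuous R 1 r 0 i d.
  exact: (cvgMl_tmp cc).
have Kc : compact (f @` box).
  apply: continuous_compact; first exact: continuous_subspaceT.
  apply: (@rV_compact R r (fun=> `[- M, - m]%classic `|` `[m, M]%classic)) => i.
  apply: compactU; exact: segment_compact.
have KG : f @` box `<=` @GLR R r.
  move=> _ [d /boxP dM <-]; rewrite /GLR /= unitmx_mul gu /= unitmxE det_diag.
  rewrite unitfE; apply/prodf_neq0 => i _; rewrite -normr_gt0.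
  by case/andP: (dM i) => h _; exact: lt_le_trans h.
have cl : compact (@lattice_class R r @` [set x | (f @` box) (set_val x)]).
  apply: continuous_compact; last exact: set_val_preimage_compact.
  by apply: continuous_subspaceT; exact: pi_continuous.
rewrite /Defs.periodic.
suff <- : @lattice_class R r @` [set x | (f @` box) (set_val x)] =
  @lattice_class R r @` [set x | exists2 t, diag_torus t & set_val x = X v *m t].
  exact: cl.
apply/seteqP; split=> [_ [x [d /boxP dM dx] <-]|_ [x [_ [d d0 <-] xE] <-]].
  exists x => //; exists (diag_mx d) => //.
  exists d => // i; rewrite -normr_gt0.
  by case/andP: (dM i) => h _; exact: lt_le_trans h.
(* Homothety allows for determinant 1, as bounded_units requires. *)
pose rho := \prod_i `|d 0 i|.
have rho0 : 0 < rho by apply: prodr_gt0 => i _; rewrite normr_gt0; exact: d0.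
pose l := rho `^ (- r%:R^-1).
have l0 : 0 < l by exact: powR_gt0.
have lr : l ^+ r * rho = 1.
  rewrite -powR_mulrn ?(ltW l0) // -powRrM mulNr mulVf ?pnatr_eq0 -?lt0n //.
  by rewrite powR_inv1 ?(ltW rho0) // mulVf // lt0r_neq0.
have ld0 i : 0 < l * `|d 0 i| by rewrite mulr_gt0 // normr_gt0; exact: d0.
have ld1 : \prod_i (l * `|d 0 i|) = 1.
  by rewrite big_split /= prodr_const card_ord.
have [u [u0 Au Au' u1 uM]] := MP _ ld0 ld1.
pose d' : 'rV[R]_r := \row_i (l * d 0 i * j i u).
have d'E i : `|d' 0 i| = l * `|d 0 i| * `|j i u|.
  by rewrite mxE !normrM (gtr0_norm l0).
have d'1 : \prod_i `|d' 0 i| = 1.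
  by under eq_bigr do rewrite d'E; rewrite big_split /= ld1 u1 mulr1.
have d'M i : m <= `|d' 0 i| <= M.
  apply/andP; split; last by rewrite d'E.
  rewrite /m -[X in X <= _]mul1r ler_pdivrMr ?exprn_gt0 //.
  move: d'1; rewrite (bigD1 i) //= => <-; apply: ler_wpM2l => //.
  apply: (@le_trans _ _ (\prod_(k < r | k != i) M)).
    by apply: ler_prod => k _; rewrite normr_ge0 d'E uM.
  by rewrite prodr_const cardC1 card_ord.
have fG : f d' \in @GLR R r.
  by apply/mem_set/KG; exists d' => //; apply/boxP.
exists (SigSub fG); first by exists d' => //; exact/boxP.
apply/esym/eqmodP/asboolP.
have [uU uUu XU] : exists2 U : 'M[int]_r, U \in unitmx &
    X v *m diag_mx (emb_diag u) = map_mx intr U *m X v.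
  have [_ stab] := class_stable CC Ca.
  have ua : a = [set u * y | y in a].
    apply/seteqP; split=> [y ay|_ [y ay <-]]; last exact: stab.
    by exists (u^-1 * y); [exact: stab | rewrite mulVKf].
  have := Zbasis_scale u0 av; rewrite -ua => /(Zbasis_change av)[U uU UE].
  by exists U => //; rewrite -real_mx_scale (real_mx_comb UE).
exists l, (map_mx intr uU); split; [exact: lt0r_neq0 | exact: map_intr_GLZ |].
rewrite -[LHS]/(X v *m diag_mx d') xE mulmxA -XU -mulmxA.
have -> : d' = l *: (\row_i (emb_diag u 0 i * d 0 i)).
  by apply/rowP => i; rewrite !mxE -mulrA (mulrC (d 0 i)).
rewrite linearZ -scalemxAr; congr (_ *: (_ *m _)).
by apply/matrixP => k i; rewrite mul_diag_mx !mxE mulrnAr.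
Qed.

Lemma torus_orbit_translate C a (v : 'I_r -> Qplus z) :
  ideal_classes z C -> C a -> Zbasis a v ->
  is_translate_of_periodic_orbit (torus_orbit j v).
Proof.
move=> CC Ca av.
have [h hu hE] := Qmx_sqrt p_prime p_ge5 r_def z_prim j_spec.
exists (X v), h; split=> //; first exact: real_mx_unit CC Ca av.
  exact: real_mx_periodic CC Ca av.
rewrite (torus_orbitE p_prime p_ge5 r_def z_prim j_spec).
have key t : (X v *m t *m Qmx j) *m (X v *m t *m Qmx j)^T =
    (X v *m t *m h) *m (X v *m t *m h)^T.
  move: (Qmx j) hE => Q hE.
  by rewrite !trmx_mul !mulmxA -[_ *m Q *m _]mulmxA hE !mulmxA.
by apply/seteqP; split=> Y [c [t [c0 tT ->]]]; exists c, t; split; rewrite ?key.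
Qed.

End PeriodicOrbits.

(** * Embeddings of number fields and the dihedral group *)

(** The elements outside the subgroup of rotations invert the rotations, and no
    rotation has order 2 because p is odd. *)
Lemma dihedral_inversion (gT : finGroupType) (G : {group gT}) (p : nat) :
  odd p -> prime p -> (G \isog finset.setTfor 'D_(p.*2))%g ->
  #|G| = p.*2 /\ exists2 x, x \in G & #[x]%g = p /\
    forall h, h \in G -> (h * h = 1)%g -> (h != 1)%g -> (x ^ h = x^-1)%g.
Proof.
move=> op pp; have p1 := prime_gt1 pp.
case/(isoGrpP _ (Grp_dihedral p1)); rewrite card_dihedral // => oG.
case/existsP=> -[x y] /= /eqP[defG xp y2 xy]; split=> //.
have{} defG : (<[x]> * <[y]> = G)%g.
  by rewrite -norm_joinEr // norms_cycle xy groupV cycle_id.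
have ox : #[x]%g = p.
  have /primeP[_ /(_ #[x]%g)] := pp; rewrite order_dvdn xp eqxx => /(_ isT).
  case/orP => /eqP // x1.
  have : (#|G| <= #[x]%g * #[y]%g)%N 
    by rewrite -defG /order mul_cardG leq_pmulr // cardG_gt0.
  rewrite oG x1 mul1n => le; have : (#[y]%g <= 2)%N by rewrite dvdn_leq // order_dvdn y2.
  by lia.
exists x; first by rewrite -cycle_subG -defG mulG_subl.
split=> // h; rewrite -defG => /mulsgP[a b /cycleP[i ->] /cycleP[k ->] ->] hh h1.
have [b1|b1] : (y ^+ k = 1 \/ y ^+ k = y)%g.
  rewrite -(odd_double_half k) expgD -mul2n expgM y2 expg1n mulg1.
  by case: (odd k); [right | left].
- case/negP: h1; rewrite b1 mulg1 -order_dvdn ox.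
  move: hh; rewrite b1 mulg1 -expgD addnn => /eqP; rewrite -order_dvdn ox.
  by rewrite -mul2n Gauss_dvdr // coprimen2.
- rewrite b1 conjgM; suff -> : (x ^ (x ^+ i))%g = x by [].
  by rewrite conjgE -expgS expgSr mulKg.
Qed.

Lemma primitive_element (K : fieldExtType rat) : exists a : K, <<1; a>>%VS = {:K}%VS.
Proof.
exists (separable_generator 1 {:K}); apply/esym/eq_adjoin_separable_generator.
  apply/separableP => y _; apply: pcharf0_separable => q.
  by rewrite pchar_lalg pchar_num.
exact: sub1v.
Qed.

Lemma map_poly_ratr (A B : fieldType) (f : {rmorphism A -> B}) (q : {poly rat}) :
  map_poly f (map_poly ratr q) = map_poly ratr q.
Proof.
have r0 (D : fieldType) : ratr 0 = 0 :> D by rewrite /ratr mul0r.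
by apply/polyP => i; rewrite coef_map /= !coef_map_id0 ?r0 // fmorph_rat.
Qed.

Lemma rmorph_horner_rat (A B : fieldType) (f : {rmorphism A -> B}) (q : {poly rat}) x :
  f (map_poly ratr q).[x] = (map_poly ratr q).[f x].
Proof. by rewrite -horner_map /= map_poly_ratr. Qed.

Lemma adjoin_horner (K : fieldExtType rat) (a x : K) : <<1; a>>%VS = {:K}%VS ->
  exists q : {poly rat}, x = (map_poly ratr q).[a].
Proof.
move=> aK; have : x \in <<1; a>>%VS by rewrite aK memvf.
case/Fadjoin_polyP => _ /polyOver1P[q ->] ->; exists q; congr (_.[_]).
by apply: eq_map_poly => c; exact: (fmorph_eq_rat (in_alg K)).
Qed.

Lemma eq_rmorph_gen (K : fieldExtType rat) (C : fieldType) (s s' : {rmorphism K -> C}) a :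
  <<1; a>>%VS = {:K}%VS -> s a = s' a -> s =1 s'.
Proof.
move=> aK ss' x; have [q ->] := adjoin_horner x aK.
by rewrite !rmorph_horner_rat ss'.
Qed.

Section Embeddings.
Variable R : realType.

(** Send a primitive element to any root of its minimal polynomial. *)
Lemma emb_exists (L : fieldExtType rat) : exists f : L -> R[i],
  zmod_morphism f /\ monoid_morphism f.
Proof.
have [a aL] := primitive_element L.
have /polyOver1P[q qE] := minPolyOver 1%AS a.
have [c qc] : exists c : R[i], root (map_poly ratr q) c.
  apply/closed_rootP; rewrite size_map_poly -(size_map_poly (in_alg L)) -qE.
  by rewrite size_minPoly.
have E : map_poly ratr =1 map_poly (in_alg L) :> ({poly rat} -> {poly L}).
  by apply: eq_map_poly => b; rewrite -(fmorph_eq_rat (in_alg L)).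
have /choice[h hP] : forall x, exists g : {poly rat}, x = (map_poly (in_alg L) g).[a].
  by move=> x; have [g ->] := adjoin_horner x aL; exists g; rewrite E.
have wd0 (g : {poly rat}) : (map_poly (in_alg L) g).[a] = 0 ->
    (map_poly ratr g).[c] = 0.
  move=> /eqP ga; have : minPoly 1 a %| map_poly (in_alg L) g.
    by apply: minPoly_dvdp => //; apply/polyOver1P; exists g.
  rewrite qE dvdp_map => /dvdpP[k ->].
  by rewrite rmorphM hornerM (rootP qc) mulr0.
have wd (g g' : {poly rat}) :
    (map_poly (in_alg L) g).[a] = (map_poly (in_alg L) g').[a] ->
    (map_poly ratr g).[c] = (map_poly ratr g').[c].
  move=> gg'; apply/eqP; rewrite -subr_eq0 -hornerN -hornerD -rmorphB; apply/eqP.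
  by apply: wd0; rewrite rmorphB hornerD hornerN gg' subrr.
exists (fun x => (map_poly ratr (h x)).[c]); split=> [x y|].
  rewrite -hornerN -hornerD -rmorphB; apply: wd.
  by rewrite -hP rmorphB hornerD hornerN -!hP.
split=> [|x y].
  rewrite -(hornerC 1 c) -[1%:P](rmorph1 (map_poly ratr)); apply: wd.
  by rewrite -hP rmorph1 hornerC.
rewrite -hornerM -rmorphM; apply: wd.
by rewrite -hP rmorphM hornerM -!hP.
Qed.

(** For a primitive element a of K, s a is a root of the image under psi of the
    minimal polynomial of f a, which splits in L into factors 'X - g (f a). *)
Lemma emb_gal (K : fieldExtType rat) (L : splittingFieldType rat)
    (f : {rmorphism K -> L}) (s : {rmorphism K -> R[i]}) (psi : {rmorphism L -> R[i]}) :
  galois 1%AS {:L}%AS ->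
  exists2 g : gal_of {:L}%AS, g \in 'Gal({:L}%AS / 1%AS)%g &
    forall x, s x = psi (g (f x)).
Proof.
move=> galL; have [a aK] := primitive_element K.
have /(galois_factors (sub1v _))/(_ (f a) (memvf _)) [rs /= [rsG _ mE]] := galL.
have /polyOver1P[q qE] := minPolyOver 1%AS (f a).
have E : map_poly ratr q = minPoly 1 (f a).
  by rewrite qE; apply: eq_map_poly => b; rewrite -(fmorph_eq_rat (in_alg L)).
have sa : (map_poly ratr q).[s a] = 0.
  rewrite -rmorph_horner_rat; apply/eqP; rewrite fmorph_eq0 -(fmorph_eq0 f).
  by rewrite rmorph_horner_rat E; exact: root_minPoly.
have : \prod_(g <- rs) (s a - psi (g (f a))) == 0.
  rewrite -sa -(map_poly_ratr psi) E mE rmorph_prod horner_prod big_map.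
  by apply/eqP/eq_bigr => g _; rewrite /= map_polyXsubC hornerXsubC.
rewrite prodf_seq_eq0 => /hasP[g gr /= /eqP/subr0_eq sg].
exists g; first exact: (fintype.subsetP rsG).
exact: (@eq_rmorph_gen K _ s (psi \o g \o f) a aK sg).
Qed.
End Embeddings.

(** * Conjugates of a dihedral extension *)

Lemma adjoin_image (K : fieldExtType rat) (L : fieldExtType rat)
    (f : {rmorphism K -> L}) (a : K) : <<1; a>>%VS = {:K}%VS ->
  forall x, reflect (exists y, x = f y) (x \in <<1; f a>>%VS).
Proof.
move=> aK x; have E q : (map_poly (in_alg L) q).[f a] = f (map_poly ratr q).[a].
  rewrite rmorph_horner_rat; congr (_.[_]).
  by apply: eq_map_poly => b; rewrite -(fmorph_eq_rat (in_alg L)).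
apply: (iffP idP) => [/Fadjoin_polyP[_ /polyOver1P[q ->] ->]|[y ->]].
  by rewrite E; eexists.
have [q ->] := adjoin_horner y aK; rewrite -E.
by apply/Fadjoin_polyP; exists (map_poly (in_alg L) q) => //; apply/polyOver1P; exists q.
Qed.

Lemma dim_adjoin_image (K : fieldExtType rat) (L : fieldExtType rat)
    (f : {rmorphism K -> L}) (a : K) : <<1; a>>%VS = {:K}%VS ->
  \dim <<1; f a>> = \dim {:K}.
Proof.
move=> aK.
have fZ : scalable f.
  move=> b x; rewrite -mulr_algl rmorphM -[RHS]mulr_algl; congr (_ * _).
  have := fmorph_eq_rat (f \o in_alg K : {rmorphism rat -> L}) b.
  by rewrite -(fmorph_eq_rat (in_alg L)).
have f_lin : linear f by move=> b x y; rewrite rmorphD /= fZ.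
pose g : {linear K -> L} := HB.pack (f : K -> L) (GRing.isLinear.Build rat K L *:%R f f_lin).
rewrite -(limg_dim_eq (f := linfun g)).
  congr (\dim _); apply/vspaceP => x; apply/(adjoin_image f aK)/memv_imgP.
    by case=> y ->; exists y; rewrite ?memvf ?lfunE.
  by case=> y _ ->; exists y; rewrite lfunE.
apply/eqP; rewrite -subv0; apply/subvP => x; rewrite memv_cap memv_ker lfunE /=.
by rewrite fmorph_eq0 => /andP[_ /eqP ->]; rewrite memv0.
Qed.

Lemma alg_integer_rmorph (K L : fieldExtType rat) (f : {rmorphism K -> L}) x :
  alg_integer (f x) <-> alg_integer x.
Proof.
have E q : map_poly f (map_poly intr q) = map_poly intr q :> {poly L}.
  by rewrite -map_poly_comp; apply: eq_map_poly => m /=; rewrite rmorph_int.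
split=> -[q qm qx]; exists q => //.
  by rewrite -(fmorph_root f) /= E.
by rewrite -E fmorph_root.
Qed.

Lemma alg_integerM (K : fieldExtType rat) (x y : K) :
  alg_integer x -> alg_integer y -> alg_integer (x * y).
Proof. exact: (@integral_mul _ _ (intr : {rmorphism int -> K})). Qed.

Section DihedralEmbeddings.
Variables (R : realType) (K : fieldExtType rat) (p r : nat).
Hypotheses (p_prime : prime p) (p_eq : p = r.*2.+1).
Hypothesis K_Dp : Dp_extension p K.
Variables (iota : {rmorphism K -> R}) (tau : 'I_r -> {rmorphism K -> R[i]}).
Hypothesis embK : embeddings_spec iota tau.

(** The real part of s is then a ring morphism to R, and iota is the only one. *)
Lemma real_emb_eq (s : {rmorphism K -> R[i]}) :
  (forall x, complex.Im (s x) = 0) -> forall x, s x = real_complex R (iota x).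
Proof.
move=> s_real; pose t x := complex.Re (s x).
have sE x : s x = real_complex R (t x).
  by rewrite /t; move: (s_real x); case: (s x) => a b /= ->.
have tB : zmod_morphism t.
  by move=> x y; apply: complexI; rewrite -sE !rmorphB /= -!sE.
have tM : monoid_morphism t.
  split=> [|x y]; apply: complexI; first by rewrite -sE !rmorph1.
  by rewrite -sE !rmorphM /= -!sE.
pose t' : {rmorphism K -> R} := HB.pack t
  (GRing.isZmodMorphism.Build K R t tB) (GRing.isMonoidMorphism.Build K R t tM).
by case: embK => /(_ t') E _ _ _ x; rewrite sE -E.
Qed.

(** Here e k is psi o sigma^k o f, where psi extends iota and sigma has order
    p, and T is the action of the group ring element sigma + sigma^-1, which
    commutes with complex conjugation c. The group of L over f K has order 2,
    hence it is generated by c: this gives the injectivity of k |-> e k modulo p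
    and the existence of T. The map m matches the embeddings e 1, ..., e r with the given ones. *)
Lemma dihedral_embeddings :
  exists (e : nat -> {rmorphism K -> R[i]}) (T : K -> K) (m : 'I_r -> 'I_r),
  [/\ [/\ forall x, e 0%N x = real_complex R (iota x),
          forall k, e (k + p)%N =1 e k,
          forall k x, (k <= p)%N -> e (p - k)%N x = conjc (e k x) &
          forall k l, (k < p)%N -> (l < p)%N -> e k =1 e l -> k = l],
      forall k u, e k (T u) = e k.+1 u * e (k + p.-1)%N u,
      forall u, alg_integer u -> alg_integer (T u) &
      injective m /\ forall (k : 'I_r) u,
        ComplexField.Normc.normc (tau (m k) u) = ComplexField.Normc.normc (e k.+1 u)].
Proof.
have [dimK [L [f [[galL _] isoL]]]] := K_Dp.
have odd_p : odd p by rewrite p_eq /= odd_double.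
have [oG [sg sgG [osg sg_inv]]] := dihedral_inversion odd_p p_prime isoL.
have [a aK] := primitive_element K.
have [psi0 [psi0B psi0M]] := emb_exists R L.
pose psi1 : {rmorphism L -> R[i]} := HB.pack psi0
  (GRing.isZmodMorphism.Build L R[i] psi0 psi0B)
  (GRing.isMonoidMorphism.Build L R[i] psi0 psi0M).
(* emb_gal turns an arbitrary embedding of L into one that extends iota. *)
have [psi psiE] : exists psi : {rmorphism L -> R[i]},
    forall x, psi (f x) = real_complex R (iota x).
  have [g _ gE] := emb_gal f (real_complex R \o iota) psi1 galL.
  by exists (psi1 \o g) => x; exact/esym/gE.
have [c cG cE] := emb_gal (idfun : {rmorphism L -> L}) (conjc \o psi) psi galL.
have cfx x : c (f x) = f x.
  by apply: (fmorph_inj psi); rewrite -cE /= psiE conjc_real.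
pose M := <<1; f a>>%AS.
pose H := 'Gal({:L} / M)%g.
have memM x : reflect (exists y, x = f y) (x \in M) by exact: adjoin_image.
have galM' : galois M {:L} by apply: galoisS galL; rewrite sub1v subvf.
have oH : #|H| = 2%N.
  rewrite -(galois_dim galM').
  have := galois_dim galL; rewrite oG dimv1 divn1 => ->.
  by rewrite (dim_adjoin_image f aK) dimK -mul2n mulnK // prime_gt0.
have memH (g : gal_of {:L}) : g \in H <-> forall x, g (f x) = f x.
  split=> [gH x|gf].
    by apply: (fixed_gal (subvf _) gH); apply/memM; exists x.
  rewrite /H gal_kHom ?subvf //; apply/kHomP; split=> [x y _ _|x /memM[y ->]] //.
  exact: rmorphM.
have cc : (c * c)%g = 1%g.
  apply/eqP/gal_eqP => x xL; rewrite galM // gal_id; apply: (fmorph_inj psi).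
  by rewrite -!cE /= -cE /= conjcK.
have sgH k : (sg ^+ k)%g \in H -> (p %| k)%N.
  move=> /order_dvdG; rewrite oH => o2.
  have op : (#[sg ^+ k]%g %| p)%N by rewrite order_dvdn -expgM mulnC expgM -osg expg_order expg1n.
  rewrite -osg order_dvdn -order_eq1 -dvdn1 -(eqP (_ : coprime 2 p)) ?dvdn_gcd ?o2 //.
  by rewrite coprime2n.
pose e k : {rmorphism K -> R[i]} := psi \o (sg ^+ k)%g \o f.
have e0 x : e 0%N x = real_complex R (iota x) by rewrite /e /= gal_id.
have e_inj k l : (k < p)%N -> (l < p)%N -> e k =1 e l -> k = l.
  wlog kl : k l / (k <= l)%N.
    by move=> W kp lp kl; have [/W|/ltnW/W] := leqP k l; [apply|move=> E; apply/esym/E].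
  move=> kp lp ekl; have /sgH : (sg ^+ (l - k))%g \in H.
    apply/memH => x; apply: (fmorph_inj (sg ^+ k)%g).
    apply: etrans (esym (galM _ _ (memvf _))) _; rewrite -expgD subnK //.
    by apply: (fmorph_inj psi); have := ekl x; rewrite /e /= => ->.
  move=> pl; apply/eqP; rewrite eqn_leq kl -subn_eq0 /=.
  by apply: contraTT pl => ?; rewrite gtnNdvd; lia.
have c1 : c != 1%g.
  apply/eqP => c1; have p2 := prime_gt1 p_prime.
  have psi_real y : complex.Im (psi y) = 0.
    have := cE y; rewrite c1 gal_id /=.
    by move: (psi y) => [u v] /= [/eqP]; rewrite eqNr => /eqP.
  have e01 : e 0%N =1 e 1%N.
    move=> x; rewrite e0; apply/esym/real_emb_eq => y; exact: psi_real.
  by have := e_inj 0%N 1%N (ltnW p2) p2 e01.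
have c_sg k x : c ((sg ^+ k)%g (f x)) = (sg ^- k)%g (f x).
  have -> : c ((sg ^+ k)%g (f x)) = ((sg ^+ k) * c)%g (f x) by rewrite galM ?memvf.
  rewrite conjgC conjXg (sg_inv c cG cc c1) expgVn galM ?memvf //.
  by rewrite cfx.
have e_per k : e (k + p)%N =1 e k.
  by move=> x; rewrite /e /= expgD -osg expg_order mulg1.
have e_conj k x : (k <= p)%N -> e (p - k)%N x = conjc (e k x).
  move=> kp; rewrite /e /=; have := cE ((sg ^+ k)%g (f x)); rewrite /= => ->.
  rewrite c_sg; congr (psi _); suff -> : (sg ^- k)%g = (sg ^+ (p - k))%g by [].
  by apply/eqP; rewrite eq_invg_mul -expgD subnKC // -osg expg_order.
have H_fix x : c x = x -> exists y, f y = x.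
  move=> cx; have /memM[y ->] : x \in M; last by exists y.
  rewrite -(galois_fixedField galM'); apply/fixedFieldP => [|h hH]; first exact: memvf.
  have cH : c \in H by apply/memH.
  have Hc : <[c]>%g = H.
    apply/eqP; rewrite finset.eqEcard cycle_subG cH oH -orderE.
    by rewrite (@nt_prime_order _ 2) // expgS expg1.
  have /cycleP[k ->] : h \in <[c]>%g by rewrite Hc; exact: hH.
  elim: k => [|k IH]; first by rewrite expg0 gal_id.
  by rewrite expgS galM ?memvf // cx.
have /choice[T TE] : forall u, exists y, f y = sg (f u) * (sg^-1)%g (f u).
  move=> u; apply: H_fix.
  have h1 : c (sg (f u)) = (sg^-1)%g (f u) by have := c_sg 1%N u; rewrite expg1.
  have h2 : c ((sg^-1)%g (f u)) = sg (f u).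
    by rewrite -h1; apply: etrans (esym (galM _ _ (memvf _))) _; rewrite cc gal_id.
  by rewrite rmorphM /= h1 h2 mulrC.
have p2 := prime_gt1 p_prime.
have /choice[m mP] : forall k : 'I_r, exists l, conj_pair (e k.+1) (tau l).
  move=> k; case: embK => _ _ _; apply.
  apply: contrapT => /forallNP real_k.
  have lt : (k.+1 < p)%N by have := ltn_ord k; rewrite p_eq; lia.
  have E : e 0%N =1 e k.+1.
    move=> x; rewrite e0; apply/esym/real_emb_eq => y.
    by apply/eqP/negPn/negP/real_k.
  by have := e_inj 0%N _ (ltnW p2) lt E.
exists e, T, m; split=> //.
- move=> k u; have cmp i x : (sg ^+ k)%g ((sg ^+ i)%g x) = (sg ^+ (i + k))%g x.
    by rewrite expgD galM ?memvf.
  have sgV : (sg^-1)%g = (sg ^+ p.-1)%g.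
    by apply/eqP; rewrite eq_invg_mul -expgS prednK -?osg ?expg_order // osg ltnW.
  have TE' : f (T u) = (sg ^+ 1)%g (f u) * (sg ^+ p.-1)%g (f u).
    by rewrite expg1 TE sgV.
  by rewrite /e /= TE' !rmorphM /= !cmp add1n addnC.
- move=> u uint; apply/(alg_integer_rmorph f); rewrite TE.
  have sint (g : gal_of {:L}) : alg_integer (g (f u)).
    apply/(alg_integer_rmorph (g : {rmorphism L -> L})).
    exact/(alg_integer_rmorph f).
  exact: alg_integerM.
split.
- move=> k l mkl.
  have rk : (k.+1 < p)%N by have := ltn_ord k; lia.
  have rl : (l.+1 < p)%N by have := ltn_ord l; lia.
  have [E|E] : e k.+1 =1 e l.+1 \/ e k.+1 =1 e (p - l.+1)%N.
    have := mP k; have := mP l; rewrite -mkl.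
    have cj x : e (p - l.+1)%N x = conjc (e l.+1 x) by rewrite e_conj // ltnW.
    move=> [A|A] [D|D]; [left|right|right|left] => x; rewrite ?cj D A ?conjcK //.
  + by apply/val_inj/eq_add_S/e_inj.
  + have := ltn_ord k; have := ltn_ord l.
    by have := e_inj _ _ rk _ E; lia.
- move=> k u; have [->|->] := mP k => //.
  by case: (tau _ _) => x y /=; rewrite sqrrN.
Qed.
End DihedralEmbeddings.

(** * Orders, traces and norms *)

Lemma common_denominator (I : finType) (f : I -> rat) :
  exists2 d : int, d != 0 & forall i, exists m : int, d%:~R * f i = m%:~R.
Proof.
exists (\prod_i denq (f i)); first by apply/prodf_neq0 => i _; rewrite denq_neq0.
move=> i; exists (numq (f i) * \prod_(k | k != i) denq (f k)).
rewrite (bigD1 i) //= !intrM -{2}[f i]divq_num_den mulrACA.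
by field; rewrite intr_eq0 denq_neq0.
Qed.

(** The entries of w form an eigenvector of U, so x is a root of its
    characteristic polynomial. *)
Lemma multiplier_integral (K : fieldExtType rat) (n : nat) (w : 'cV[K]_n) (x : K)
    (U : 'M[int]_n) :
  w != 0 -> x *: w = map_mx intr U *m w -> alg_integer x.
Proof.
move=> w0 xw; exists (char_poly U^T); first exact: char_poly_monic.
rewrite map_char_poly -eigenvalue_root_char; apply/eigenvalueP.
exists w^T; last by apply: contra_neq w0 => /(congr1 trmx); rewrite trmxK trmx0.
by rewrite -map_trmx -trmx_mul -xw linearZ.
Qed.

Lemma integral_rat_int (C : numClosedFieldType) (q : rat) :
  integralOver (intr : int -> C) (ratr q) -> exists m : int, q = m%:~R.
Proof.
case=> g gm gq; have gq' : root (map_poly (ratr : rat -> algC) (map_poly intr g)) (ratr q).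
  rewrite fmorph_root -(fmorph_root (ratr : {rmorphism rat -> C})) -map_poly_comp.
  by congr (root _ _): gq; apply: eq_map_poly => m; rewrite /= ratr_int.
have : ratr q \in Aint.
  apply: root_monic_Aint gq' _ _.
    by rewrite map_monic monic_map.
  apply/polyOverP => i; rewrite !coef_map /= ratr_int; exact: intr_int.
move=> /(Cint_rat_Aint (Crat_rat q))/intrP[m mE].
by exists m; apply: (fmorph_inj (ratr : {rmorphism rat -> algC})); rewrite /= mE ratr_int.
Qed.

Lemma emb_mx_rat (R : realType) (K : fieldExtType rat) (n : nat)
    (e : 'I_n -> {rmorphism K -> R[i]}) (m k : nat) (X : 'M[rat]_(m, k)) (v : 'cV[K]_k) :
  emb_mx e (map_mx (in_alg K) X *m v) = map_mx ratr X *m emb_mx e v.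
Proof.
apply/matrixP => a i; rewrite !mxE rmorph_sum; apply: eq_bigr => b _.
by rewrite !mxE /= mulr_algl rmorph_ratZ.
Qed.

(** The Vandermonde matrix of the conjugates of a primitive element a is
    invertible, and a^0, ..., a^(n-1) are rational combinations of v. *)
Lemma rational_basis (R : realType) (K : fieldExtType rat) (n : nat)
    (e : 'I_n -> {rmorphism K -> R[i]}) :
  \dim {:K} = n -> (forall k l, e k =1 e l -> k = l) ->
  exists v : 'cV[K]_n, emb_mx e v \in unitmx /\
  forall m (y : 'cV[K]_m), exists X : 'M[rat]_(m, n), y = map_mx (in_alg K) X *m v.
Proof.
move=> dimK e_inj; subst n; pose v : 'cV[K]_(\dim {:K}) := \col_k (vbasis {:K})`_k; exists v.
have vP m (y : 'cV[K]_m) : exists X : 'M[rat]_(m, \dim {:K}), y = map_mx (in_alg K) X *m v.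
  exists (\matrix_(a, k) coord (vbasis {:K}) k (y a 0)).
  apply/colP => a; rewrite [LHS](coord_vbasis (memvf _)) !mxE.
  by apply: eq_bigr => k _; rewrite !mxE mulr_algl.
split=> //; have [a aK] := primitive_element K.
have [X XP] := vP _ (\col_(k < \dim {:K}) a ^+ k).
suff : emb_mx e (\col_(k < \dim {:K}) a ^+ k) \in unitmx.
  by rewrite XP emb_mx_rat unitmx_mul => /andP[].
have -> : emb_mx e (\col_(k < \dim {:K}) a ^+ k) =
    Vandermonde _ (\row_i e i a).
  by apply/matrixP => k i; rewrite !mxE rmorphXn.
rewrite unitmxE det_Vandermonde unitfE.
apply/prodf_neq0 => i _; apply/prodf_neq0 => k ik; rewrite !mxE subr_eq0.
apply: contraTneq ik => /(eq_rmorph_gen aK)/e_inj ->.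
by rewrite ltnn.
Qed.

Section IntegralBasis.
Variables (R : realType) (K : fieldExtType rat) (n : nat).
Variable e : 'I_n -> {rmorphism K -> R[i]}.

Hypothesis dimK : \dim {:K} = n.
Hypothesis e_inj : forall k l, e k =1 e l -> k = l.

(** If the products of the v_k have coordinates with common denominator d, then
    the lattice spanned by d v is stable under multiplication. *)
Lemma order_basis : exists w : 'cV[K]_n, [/\ emb_mx e w \in unitmx,
  forall k, exists S : 'M[int]_n, w k 0 *: w = map_mx intr S *m w &
  forall x, exists X : 'M[rat]_n, x *: w = map_mx (in_alg K) X *m w].
Proof.
have [v [vu vP]] := rational_basis dimK e_inj.
have /choice[S SP] := fun k : 'I_n => vP _ (v k 0 *: v).
have [d d0 dP] := common_denominator (fun k : 'I_n * 'I_n * 'I_n => S k.1.1 k.1.2 k.2).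
have /choice[m mP] := dP.
have dn0 : d%:~R != 0 :> K.
  by rewrite -(rmorph_int (in_alg K)) fmorph_eq0 intr_eq0.
exists (d%:~R *: v); split.
- rewrite emb_mxZ unitmx_mul vu unitmxE det_diag unitfE.
  by apply/prodf_neq0 => i _; rewrite mxE fmorph_eq0.
- move=> k; exists (\matrix_(a, b) m (k, a, b)).
  have -> : map_mx intr (\matrix_(a, b) m (k, a, b)) =
      d%:~R *: map_mx (in_alg K) (S k) :> 'M[K]_n.
    apply/matrixP => a b; rewrite !mxE.
    have := congr1 (in_alg K) (mP (k, a, b)); rewrite rmorphM !rmorph_int /= => <-.
    by [].
  rewrite -scalemxAl -scalemxAr -SP mxE -scalerA; congr (_ *: _).
  by rewrite scalerA mulrC -scalerA.
- move=> x; have [X XP] := vP _ (x *: v); exists X.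
  by rewrite -scalemxAr -XP !scalerA mulrC.
Qed.

Variable w : 'cV[K]_n.
Hypothesis w_unit : emb_mx e w \in unitmx.
Hypothesis w_rat : forall x, exists X : 'M[rat]_n, x *: w = map_mx (in_alg K) X *m w.

Let emb_integral x i : alg_integer x -> integralOver (intr : int -> R[i]) (e i x).
Proof.
case=> g gm gx; exists g => //.
have -> : map_poly intr g = map_poly (e i) (map_poly intr g).
  by rewrite -map_poly_comp; apply: eq_map_poly => m; rewrite /= rmorph_int.
by rewrite fmorph_root.
Qed.

Let rat_mult x : exists X : 'M[rat]_n,
  map_mx ratr X = emb_mx e w *m diag_mx (emb_row e x) *m invmx (emb_mx e w).
Proof.
have [X XP] := w_rat x; exists X.
by rewrite -emb_mxZ XP emb_mx_rat mulmxK.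
Qed.

Lemma trace_int x : alg_integer x -> exists m : int, \sum_i e i x = m%:~R.
Proof.
move=> xint; have [X XE] := rat_mult x.
have trX : ratr (\tr X) = \sum_i e i x.
  rewrite -trace_map_mx XE mxtrace_mulC mulmxA mulVmx // mul1mx mxtrace_diag.
  by apply: eq_bigr => i _; rewrite mxE.
have [|m mE] := @integral_rat_int R[i] (\tr X).
  rewrite trX; elim/big_ind: _ => [|y y' iy iy'|i _].
  - exact: (mxpoly.integral0 (intr : {rmorphism int -> R[i]})).
  - exact: (@integral_add _ _ (intr : {rmorphism int -> R[i]})).
  - exact: emb_integral.
by exists m; rewrite -trX mE ratr_int.
Qed.

Lemma norm_int x : alg_integer x -> exists m : int, \prod_i e i x = m%:~R.
Proof.
move=> xint; have [X XE] := rat_mult x.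
have detX : ratr (\det X) = \prod_i e i x.
  rewrite -det_map_mx XE det_mulmx mulrC -det_mulmx mulmxA mulVmx // mul1mx det_diag.
  by apply: eq_bigr => i _; rewrite mxE.
have [|m mE] := @integral_rat_int R[i] (\det X).
  rewrite detX; elim/big_ind: _ => [|y y' iy iy'|i _].
  - exact: (integral1 (intr : {rmorphism int -> R[i]})).
  - exact: (@integral_mul _ _ (intr : {rmorphism int -> R[i]})).
  - exact: emb_integral.
by exists m; rewrite -detX mE ratr_int.
Qed.

Lemma units_OK_norm u : units_OK u -> \prod_i normc (e i u) = 1.
Proof.
move=> [u0 uint uVint]; have [m mE] := norm_int uint; have [m' m'E] := norm_int uVint.
have : m * m' = 1.
  apply/eqP; rewrite -(eqr_int R[i]) intrM -mE -m'E -big_split /= big1 // => i _.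
  by rewrite -rmorphM divff // rmorph1.
move=> mm'; rewrite -normc_prod mE normc_intr.
have : m \is a GRing.unit by apply/unitrP; exists m'; rewrite mulrC mm'.
by case/orP => /eqP ->.
Qed.

End IntegralBasis.

(** * Logarithms of units *)

(** On the unit circle y + y^-1 is twice the real part of y. *)
Lemma root_of_unity_sum_lt2 (R : realType) (n : nat) (y : R[i]) (b : R) :
  (0 < n)%N -> y ^+ n = 1 -> y != 1 -> real_complex R b = y + y^-1 -> b < 2.
Proof.
move=> n0 yn y1 bE.
have y0 : y != 0 by apply: contra_eq_neq yn => ->; rewrite expr0n gtn_eqF // eq_sym oner_neq0.
have ny : normc y = 1.
  have : normc y ^+ n = 1.
    have <- : normc (y ^+ n) = normc y ^+ n.
      elim: (n) => [|k IH]; first by rewrite !expr0 ComplexField.Normc.normc1.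
      by rewrite !exprS ComplexField.Normc.normcM IH.
    by rewrite yn ComplexField.Normc.normc1.
  by move/eqP; rewrite pexpr_eq1 ?normc_ge0 // => /eqP.
have yb : y * (real_complex R b - y) = 1 by rewrite bE [y + _]addrC addrK divff.
case: y ny yb y1 {yn bE y0} => u v /= ny [E1 E2] y1.
have uv : u ^+ 2 + v ^+ 2 = 1.
  by rewrite -[LHS]sqr_sqrtr ?addr_ge0 ?sqr_ge0 // ny expr1n.
have {E1 E2} [E1 E2] : u * (b - u) + v ^+ 2 = 1 /\ v * (b - 2 * u) = 0.
  by split; [rewrite -[RHS]E1 | rewrite -[RHS]E2]; ring.
have [v0|v0] := eqVneq v 0.
  have : u != 1 by apply: contra_neq y1 => u1; apply/eqP; rewrite eq_complex /= u1 v0 !eqxx.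
  have : (u - 1) * (u + 1) = 0 by move: uv; rewrite v0 => uv; rewrite -subr_sqr; lra.
  move/eqP; rewrite mulf_eq0 subr_eq0 => /orP[->//|/eqP u1] _.
  have uE : u = -1 by lra.
  by move: E1; rewrite v0 uE expr0n /=; lra.
have bu : b = 2 * u.
  by apply/eqP; rewrite -subr_eq0; move/eqP: E2; rewrite mulf_eq0 (negPf v0).
have : 0 < v ^+ 2 by rewrite lt_neqAle sqr_ge0 andbT eq_sym sqrf_eq0.
by rewrite bu; nra.
Qed.

Lemma normc_sum (R : realType) (I : finType) (f : I -> R[i]) :
  normc (\sum_i f i) <= \sum_i normc (f i).
Proof.
elim/big_rec2: _ => [|i x y _ le]; first by rewrite ComplexField.Normc.normc0.
apply: le_trans (lerD (lexx _) le).
exact: le_normcD.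
Qed.

Section LogUnits.
Variables (R : realType) (p r : nat).
Hypotheses (p_prime : prime p) (p_ge5 : (5 <= p)%N) (r_def : r = ((p - 1) %/ 2)%N).
Variables (K : fieldExtType rat) (e : nat -> {rmorphism K -> R[i]}) (T : K -> K).
Hypothesis dimK : \dim {:K} = p.
Hypothesis e0_real : exists iota : K -> R, forall x, e 0 x = real_complex R (iota x).
Hypothesis e_per : forall k, e (k + p)%N =1 e k.
Hypothesis e_conj : forall k x, (k <= p)%N -> e (p - k)%N x = conjc (e k x).
Hypothesis e_inj : forall k l, (k < p)%N -> (l < p)%N -> e k =1 e l -> k = l.
Hypothesis e_T : forall k u, e k (T u) = e k.+1 u * e (k + p.-1)%N u.
Hypothesis T_integral : forall u, alg_integer u -> alg_integer (T u).

Local Notation U := (@units_OK K).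

Let pE : p = r.*2.+1 := p_eq p_prime p_ge5 r_def.
Let r1 : (1 < r)%N := r_gt1 p_prime p_ge5 r_def.
Let p0 : (0 < p)%N := prime_gt0 p_prime.

Lemma units1 : U 1.
Proof.
by split; rewrite ?invr1 ?oner_neq0 //; exact: (integral1 (intr : {rmorphism int -> K})).
Qed.

Lemma unitsM u v : U u -> U v -> U (u * v).
Proof.
move=> [u0 iu iu'] [v0 iv iv']; split; first by rewrite mulf_neq0.
  exact: alg_integerM.
by rewrite invfM; exact: alg_integerM.
Qed.

Lemma unitsV u : U u -> U u^-1.
Proof. by move=> [u0 iu iu']; split; rewrite ?invrK ?invr_eq0. Qed.

Definition log_emb (k : nat) (u : K) : R := ln (normc (e k u)).

(** The factor 2 at k > 0 comes from the pair of conjugate embeddings; it also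
    makes these numbers satisfy the same recurrence as the B_k, because
    B_1 B_1 = B_2 + 2 B_0. *)
Definition log_coord (k : nat) (u : K) : R :=
  if k == 0%N then log_emb 0 u else 2 * log_emb k u.

Definition log_row (u : K) : 'rV[R]_r := \row_k log_coord k u.

Lemma unitsT u : U u -> U (T u).
Proof.
have T0 v : v != 0 -> T v != 0.
  by move=> v0; rewrite -(fmorph_eq0 (e 0)) e_T mulf_neq0 ?fmorph_eq0.
have TV v : (T v)^-1 = T v^-1.
  by apply: (fmorph_inj (e 0)); rewrite fmorphV !e_T !fmorphV invfM.
by move=> [u0 iu iu']; split; [exact: T0 | exact: T_integral | rewrite TV; exact: T_integral].
Qed.

Lemma log_embM k u v : u != 0 -> v != 0 ->
  log_emb k (u * v) = log_emb k u + log_emb k v.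
Proof.
move=> u0 v0; rewrite /log_emb rmorphM ComplexField.Normc.normcM lnM //;
  by rewrite posrE normc_gt0 ?fmorph_eq0.
Qed.

Lemma log_rowM u v : U u -> U v -> log_row (u * v) = log_row u + log_row v.
Proof.
move=> [u0 _ _] [v0 _ _]; apply/rowP => k; rewrite !mxE /log_coord.
by case: eqP => _; rewrite log_embM // mulrDr.
Qed.

Lemma log_emb_conj k u : (k <= p)%N -> log_emb (p - k) u = log_emb k u.
Proof.
move=> kp; rewrite /log_emb e_conj //.
by case: (e k u) => a b /=; rewrite sqrrN.
Qed.

Let emb (i : 'I_p) : {rmorphism K -> R[i]} := e i.

Let emb_inj (k l : 'I_p) : emb k =1 emb l -> k = l.
Proof. by move=> kl; apply: val_inj; exact: e_inj kl. Qed.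

Lemma sum_log_emb u : U u -> \sum_(k < p) log_emb k u = 0.
Proof.
move=> Uu; have [w [wu w_mul w_rat]] := order_basis dimK emb_inj.
have prod1 := units_OK_norm wu w_rat Uu.
suff [_ lnE] : 0 < \prod_(i < p) normc (emb i u) /\
    ln (\prod_(i < p) normc (emb i u)) = \sum_(i < p) log_emb i u.
  by rewrite -lnE prod1 ln1.
elim/big_rec2: _ => [|i x y _ [y0 <-]]; first by rewrite ln1.
have ei : 0 < normc (emb i u) by rewrite normc_gt0 // fmorph_eq0; case: Uu.
by split; [exact: mulr_gt0 | rewrite lnM].
Qed.

(** The norm of a unit is 1 in absolute value; the terms k and p - k of its
    logarithm are equal. *)
Lemma sum_log_coord u : U u -> \sum_(k < r.+1) log_coord k u = 0.
Proof.
move=> Uu; rewrite -[RHS](sum_log_emb Uu) pE big_ord_recl [in RHS]big_ord_recl.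
congr (_ + _); rewrite -addnn big_split_ord /=.
have -> : \sum_(i < r) log_emb (bump 0 (r + i)) u = \sum_(i < r) log_emb i.+1 u.
  rewrite (reindex_inj rev_ord_inj); apply: eq_bigr => i _ /=.
  rewrite -[RHS]log_emb_conj; last by have := ltn_ord i; rewrite pE; lia.
  by congr log_emb; rewrite /bump pE; have := ltn_ord i; lia.
by rewrite -big_split; apply: eq_bigr => i _ /=; rewrite /log_coord /=; ring.
Qed.

Let basis_neq0 (w : 'cV[K]_p) : emb_mx emb w \in unitmx -> w != 0.
Proof.
move=> wu; apply/eqP => w0; pose i := Ordinal p0.
have : (invmx (emb_mx emb w) *m emb_mx emb w) i i = 1 by rewrite mulVmx // mxE eqxx.
rewrite mxE big1 => [/eqP|k _]; first by rewrite eq_sym oner_eq0.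
by rewrite [X in _ * X]mxE w0 mxE rmorph0 mulr0.
Qed.

(** Apply bounded_units with a weight that is large at all nonreal
    embeddings. *)
Lemma pisot_unit : exists2 u, U u & forall k, (0 < k <= r)%N -> log_emb k u < 0.
Proof.
have [w [wu w_mul _]] := order_basis dimK emb_inj.
pose s (i : 'I_p) : 'I_p := Ordinal (ltn_pmod (p - i) p0).
have sE (i : 'I_p) : s i = (if i == 0%N :> nat then 0%N else (p - i)%N) :> nat.
  rewrite /=; case: eqP => [->|]; first by rewrite subn0 modnn.
  by move=> /eqP; rewrite -lt0n => i0; rewrite modn_small // ltn_subrL i0.
have e_s i x : emb (s i) x = conjc (emb i x).
  rewrite /emb sE; case: eqP => [->|_]; last by rewrite e_conj // ltnW.
  by have [iota ->] := e0_real; rewrite conjc_real.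
have [M M0 MP] := bounded_units wu p0 w_mul e_s.
have M2 : 0 < 2 * M by rewrite mulr_gt0.
pose t (i : 'I_p) : R := if i == 0%N :> nat then (2 * M) ^- p.-1 else 2 * M.
have t0 i : 0 < t i by rewrite /t; case: ifP => // _; rewrite invr_gt0 exprn_gt0.
have ts i : t (s i) = t i.
  rewrite /t sE; case: (nat_of_ord i =P 0%N) => // _.
  by rewrite gtn_eqF // subn_gt0.
have t1 : \prod_i t i = 1.
  rewrite (bigD1 (Ordinal p0)) //= {1}/t /=.
  under eq_bigr => i i0.
    rewrite /t ifN; last by apply: contra_neq i0 => i0; apply/val_inj.
    over.
  by rewrite prodr_const cardC1 card_ord mulVf // expf_neq0 // lt0r_neq0.
have [u [W [Wu u0 uw uM]]] := MP t t0 ts t1; have w0 := basis_neq0 wu.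
exists u.
  split=> //; first exact: multiplier_integral w0 uw.
  apply: (multiplier_integral (U := invmx W) w0); apply: (scalerI u0).
  rewrite scalerA divff // scale1r scalemxAr uw mulmxA -map_mxM mulVmx //.
  by rewrite map_mx1 mul1mx.
move=> k /andP[k0 kr]; have kp : (k < p)%N by rewrite pE; lia.
have := uM (Ordinal kp); rewrite /t /= gtn_eqF // /emb /= => le.
apply: ln_lt0; rewrite normc_gt0 ?fmorph_eq0 //=.
rewrite -(ltr_pM2l M2); apply: le_lt_trans le _.
by rewrite mulr1 ltr_pMl // ltr1n.
Qed.

Variables (F : fieldExtType rat) (z : F) (z_prim : p.-primitive_root z).
Variables (phi : {rmorphism F -> R[i]}) (j : 'I_r -> {rmorphism Qplus z -> R}).
Hypothesis j_spec : forall i : 'I_r,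
  real_complex R (j i (Bplus z 1)) = phi z ^+ i.+1 + phi z ^- i.+1.

Local Notation B := (Bplus z).
Local Notation P := (Pmx j).

Let P_unit : P \in unitmx := Pmx_unit p_prime p_ge5 r_def z_prim j_spec.

(** The coordinates in which T, and with it A+, acts diagonally: log_coord k u
    is the sum of spectral u i * j i (B k) over i, for 0 <= k <= r. *)
Definition spectral (u : K) : 'rV[R]_r := log_row u *m invmx P^T.

Lemma spectralE u : log_row u = spectral u *m P^T.
Proof. by rewrite mulmxKV ?unitmx_tr. Qed.

Lemma spectralM u v : U u -> U v -> spectral (u * v) = spectral u + spectral v.
Proof. by move=> Uu Uv; rewrite /spectral log_rowM // mulmxDl. Qed.

Lemma spectral1 : spectral 1 = 0.
Proof.
by have := spectralM units1 units1; rewrite mulr1 => /eqP; rewrite -subr_eq subrr eq_sym => /eqP.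
Qed.

Lemma spectralV u : U u -> spectral u^-1 = - spectral u.
Proof.
move=> Uu; apply/eqP; rewrite -addr_eq0 -(spectralM (unitsV Uu) Uu) mulVf ?spectral1 //.
by case: Uu.
Qed.

Lemma spectral_power u m : U u -> exists2 v, U v & spectral v = spectral u *~ m.
Proof.
move=> Uu; suff H (n : nat) : exists2 v, U v & spectral v = spectral u *~ n.
  case: m => n; first exact: H.
  have [v Uv vE] := H n.+1; exists v^-1; first exact: unitsV.
  by rewrite spectralV // vE NegzE mulrNz.
elim: n => [|n [v Uv vE]]; first by exists 1; [exact: units1 | exact: spectral1].
exists (u * v); first exact: unitsM.
by rewrite spectralM // vE -[n.+1]add1n PoszD mulrzDr.
Qed.

Lemma spectral_comb (I : finType) (h : I -> K) (c : I -> int) :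
  (forall k, U (h k)) -> exists2 v, U v & spectral v = \sum_k spectral (h k) *~ c k.
Proof.
move=> Uh; elim/big_rec: _ => [|k x _ [v Uv <-]].
  by exists 1; [exact: units1 | exact: spectral1].
have [w Uw <-] := spectral_power (c k) (Uh k); exists (w * v); first exact: unitsM.
exact: spectralM.
Qed.

Lemma spectral_B k u : U u -> (k <= r)%N ->
  \sum_i spectral u 0 i * j i (B k) = log_coord k u.
Proof.
move=> Uu; have lt (l : 'I_r) : \sum_i spectral u 0 i * j i (B l) = log_coord l u.
  have := spectralE u => /rowP/(_ l); rewrite !mxE => ->.
  by apply: eq_bigr => i _; rewrite !mxE.
rewrite leq_eqVlt => /orP[/eqP ->|kr]; last exact: (lt (Ordinal kr)).
under eq_bigr do rewrite (j_Br p_prime p_ge5 r_def z_prim) mulrN mulr_sumr.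
rewrite sumrN exchange_big /=; under eq_bigr do rewrite lt.
by have := sum_log_coord Uu; rewrite big_ord_recr /= addrC => /eqP; rewrite addr_eq0 => /eqP.
Qed.

(** Both log_coord and the sequence B satisfy the recurrence that expresses
    multiplication by B_1; compare the values at B_0, ..., B_{r-1}. *)
Lemma spectral_T u i : U u -> spectral (T u) 0 i = spectral u 0 i * j i (B 1).
Proof.
move=> Uu; have UTu := unitsT Uu; have u0 : u != 0 by case: Uu.
have lT k : log_emb k (T u) = log_emb k.+1 u + log_emb (k + p.-1) u.
  rewrite /log_emb e_T ComplexField.Normc.normcM lnM //;
    by rewrite posrE normc_gt0 ?fmorph_eq0.
have lT0 : log_emb 0 (T u) = log_coord 1 u.
  rewrite lT add0n -subn1 (@log_emb_conj 1) ?p0 // /log_coord /=. ring.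
have lTS k : log_emb k.+1 (T u) = log_emb k.+2 u + log_emb k u.
  rewrite lT addSnnS prednK //; congr (_ + _); rewrite /log_emb; congr (ln (normc _)).
  exact: e_per.
suff : spectral (T u) = spectral u *m diag_mx (\row_i j i (B 1)).
  by move=> ->; rewrite mul_mx_diag !mxE.
apply: (can_inj (mulmxK (_ : P^T \in unitmx))); first by rewrite unitmx_tr.
rewrite /= -spectralE; apply/rowP => k; rewrite mul_mx_diag !mxE.
transitivity (\sum_i spectral u 0 i * j i (B 1 * B k)); last first.
  by apply: eq_bigr => l _; rewrite !mxE rmorphM mulrA.
have add x y : \sum_i spectral u 0 i * j i (x + y) =
    \sum_i spectral u 0 i * j i x + \sum_i spectral u 0 i * j i y.
  by rewrite -big_split; apply: eq_bigr => l _; rewrite rmorphD mulrDr.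
case: k => -[|[|k]] kr /=.
- by rewrite (B0 z_prim) mulr1 spectral_B ?(ltnW r1) // /log_coord /= lT0.
- rewrite (B1_mul1 z_prim) add mulr_natl mulr2n add !spectral_B //.
  by rewrite /log_coord /= lTS; ring.
- rewrite (B1_mulSS z_prim) add !spectral_B //; last by exact: ltnW (ltnW kr).
  by rewrite /log_coord /= lTS; ring.
Qed.

(** Inverting spectral_B by orthogonality, p times the l-th coordinate is
    2 log_coord 0 + sum_k log_coord k * j_l (B k), that is
    sum_k log_coord k * (j_l (B k) - 2) over 1 <= k <= r, as the log_coord sum to
    0. All the factors are negative. *)
Lemma spectral_gt0 u : U u -> (forall k, (0 < k <= r)%N -> log_emb k u < 0) ->
  forall l, 0 < spectral u 0 l.
Proof.
move=> Uu neg l.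
have p_gt0 : 0 < p%:R :> R by rewrite ltr0n.
rewrite -(pmulr_lgt0 _ p_gt0).
have -> : spectral u 0 l * p%:R =
    \sum_(k < r) (1 + (k == 0%N :> nat)%:R) * (log_coord k u * j l (B k)) +
    log_coord r u * j l (B r).
  transitivity (\sum_i spectral u 0 i * ((i == l)%:R * p%:R)).
    rewrite (bigD1 l) //= eqxx mul1r big1 ?addr0 // => i /negPf ->.
    by rewrite mul0r mulr0.
  under eq_bigr do rewrite -(orthogonality p_prime p_ge5 r_def z_prim j_spec) mulrDr.
  rewrite big_split /=; congr (_ + _).
    under eq_bigr do rewrite mulr_sumr.
    rewrite exchange_big; apply: eq_bigr => k _ /=.
    rewrite -(spectral_B Uu (ltnW (ltn_ord k))) mulr_suml mulr_sumr.
    apply: eq_bigr => i _; ring.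
  rewrite -(spectral_B Uu (leqnn r)) mulr_suml.
  by apply: eq_bigr => i _; ring.
rewrite (weighted_sum (fun k => log_coord k u * j l (B k)) (ltnW r1)).
rewrite (B0 z_prim) rmorph1 mulr1.
have := sum_log_coord Uu; rewrite big_ord_recl /= => /eqP; rewrite addr_eq0 => /eqP ->.
rewrite mulrN addrC mulr_sumr -sumrB.
have term (k : 'I_r) : 0 < log_coord k.+1 u * j l (B k.+1) - 2 * log_coord k.+1 u.
  have neg_k : log_coord k.+1 u < 0.
    rewrite /log_coord /= pmulr_rlt0 //; apply: neg; exact: ltn_ord.
  have lt2 : j l (B k.+1) < 2.
    apply: (root_of_unity_sum_lt2 (n := p) (y := (phi z ^+ l.+1) ^+ k.+1)) => //.
    - by rewrite -!exprM mulnC exprM -rmorphXn (prim_expr_order z_prim) rmorph1 expr1n.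
    - have phi_prim : p.-primitive_root (phi z) by rewrite fmorph_primitive_root.
      rewrite -exprM -(prim_order_dvd phi_prim) Euclid_dvdM // !gtnNdvd //;
        by have := ltn_ord l; have := ltn_ord k; rewrite pE; lia.
    - by rewrite (j_B z_prim j_spec).
  by rewrite [2 * _]mulrC -mulrBr nmulr_lgt0 // subr_lt0.
rewrite (bigD1 (Ordinal (ltnW r1))) //=; apply: ltr_pwDl; first exact: term (Ordinal (ltnW r1)).
by apply: sumr_ge0 => k _; exact: ltW.
Qed.

(** A bound on the spectral coordinates bounds all conjugates of a unit u, hence
    the integers Tr (u w_l) for a basis w of integral elements. These
    determine the conjugates of u. *)
Lemma finite_spectral (X : R) : exists N : nat, forall h : nat -> K,
  (forall n, U (h n)) -> (forall n i, `|spectral (h n) 0 i| <= X) ->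
  exists a b, [/\ (a < b)%N, (b <= N)%N & spectral (h a) = spectral (h b)].
Proof.
have [w [wu w_mul w_rat]] := order_basis dimK emb_inj.
have w_int l : alg_integer (w l 0).
  by have [S] := w_mul l; exact: multiplier_integral (basis_neq0 wu).
pose G : R := \sum_(k < r.+1) \sum_i `|j i (B k)|.
pose Y := expR (X * G).
pose W : R := \sum_l \sum_i normc (emb i (w l 0)).
pose Z := Num.truncn (Y * W).
exists #|{: {ffun 'I_p -> 'I_Z.*2.+1}}| => h Uh hX.
have X0 : 0 <= X := le_trans (normr_ge0 _) (hX 0%N (Ordinal (ltnW r1))).
have coord_le n k : (k <= r)%N -> `|log_coord k (h n)| <= X * G.
  move=> kr; rewrite -spectral_B //; apply: le_trans (ler_norm_sum _ _ _) _.
  apply: (@le_trans _ _ (\sum_i X * `|j i (B k)|)).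
    by apply: ler_sum => i _; rewrite normrM ler_wpM2r.
  rewrite -mulr_sumr ler_wpM2l // /G (bigD1 (Ordinal (kr : (k < r.+1)%N))) //=.
  by rewrite lerDl sumr_ge0 // => a _; rewrite sumr_ge0.
have emb_le n (i : 'I_p) : normc (emb i (h n)) <= Y.
  have pos : 0 < normc (emb i (h n)) by rewrite normc_gt0 // fmorph_eq0; case: (Uh n).
  rewrite -(lnK pos) /Y ler_expR.
  have log_le k : (k <= r)%N -> log_emb k (h n) <= X * G.
    move=> kr; have := coord_le n k kr; rewrite /log_coord.
    case: eqP => [->|_] le; first exact: le_trans (ler_norm _) le.
    have : 0 <= X * G by exact: le_trans le.
    by move: le; rewrite ler_norml; lra.
  have [ir|ri] := leqP i r; first exact: log_le.
  rewrite -/(log_emb i (h n)) -(log_emb_conj (h n) (ltnW (ltn_ord i))).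
  by apply: log_le; have := pE; lia.
have /choice[mu muE] : forall n, exists m : 'I_p -> int,
    forall l, \sum_i emb i (h n * w l 0) = (m l)%:~R.
  move=> n; suff /choice[m mP] : forall l, exists m : int,
      \sum_i emb i (h n * w l 0) = m%:~R by exists m.
  move=> l; apply: (trace_int wu w_rat).
  by apply: alg_integerM; [case: (Uh n) | exact: w_int].
have mu_le n l : (`|mu n l|%N <= Z)%N.
  have W0 : 0 <= W by rewrite sumr_ge0 // => a _; rewrite sumr_ge0 // => b _; exact: normc_ge0.
  rewrite /Z truncn_ge_nat ?mulr_ge0 ?expR_ge0 // -normc_intr -muE.
  apply: le_trans (normc_sum _) _.
  apply: (@le_trans _ _ (\sum_i Y * normc (emb i (w l 0)))).
    apply: ler_sum => i _; rewrite rmorphM ComplexField.Normc.normcM.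
    by rewrite ler_wpM2r ?normc_ge0.
  rewrite -mulr_sumr ler_wpM2l ?expR_ge0 // /W [X in _ <= X](bigD1 l) //= lerDl.
  by rewrite sumr_ge0 // => a _; rewrite sumr_ge0 // => b _; exact: normc_ge0.
pose code (n : 'I_#|{: {ffun 'I_p -> 'I_Z.*2.+1}}|.+1) : {ffun 'I_p -> 'I_Z.*2.+1} :=
  [ffun l => inord `|(mu n l + Z%:Z)%R|%N].
have [|a [b [ab cab]]] := @pigeonhole _ _ code; first by rewrite card_ord.
have mu_eq l : mu a l = mu b l.
  have /(congr1 val) := congr1 (fun f : {ffun _ -> _} => f l) cab.
  rewrite !ffunE /= !inordK; have := mu_le a l; have := mu_le b l; lia.
have eq_spec : spectral (h a) = spectral (h b).
  suff E (i : 'I_p) : e i (h a) = e i (h b).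
    congr (_ *m _); apply/rowP => k; rewrite !mxE /log_coord /log_emb.
    have kp : (k < p)%N by have := ltn_ord k; rewrite pE; lia.
    by rewrite (E (Ordinal p0)) (E (Ordinal kp)).
  suff /rowP/(_ i) : emb_row emb (h a) = emb_row emb (h b) by rewrite !mxE.
  apply: (can_inj (mulmxK (_ : (emb_mx emb w)^T \in unitmx))); first by rewrite unitmx_tr.
  apply/rowP => l; rewrite /= !mxE.
  have row n : \sum_k emb_row emb (h n) 0 k * (emb_mx emb w)^T k l = (mu n l)%:~R.
    by rewrite -muE; apply: eq_bigr => k _; rewrite !mxE rmorphM.
  by rewrite !row mu_eq.
have [lt|gt|E] := ltngtP a b; last by case/eqP: ab; apply: val_inj.
  by exists a, b; split=> //; rewrite -ltnS.
by exists b, a; split=> //; rewrite -ltnS.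
Qed.

End LogUnits.

(** * The unit lattice as a fractional ideal *)

Lemma mulrz_mxE (V : zmodType) (m n : nat) (M : 'M[V]_(m, n)) (c : int) i k :
  (M *~ c) i k = M i k *~ c.
Proof. by case: c => q; rewrite ?NegzE ?mulrNz -?pmulrn ?[in LHS]mxE mulmxnE. Qed.

Section UnitShape.
Variables (R : realType) (p r : nat).
Hypotheses (p_prime : prime p) (p_ge5 : (5 <= p)%N) (r_def : r = ((p - 1) %/ 2)%N).
Variables (F : fieldExtType rat) (z : F) (z_prim : p.-primitive_root z).
Variables (phi : {rmorphism F -> R[i]}) (j : 'I_r -> {rmorphism Qplus z -> R}).
Hypothesis j_spec : forall i : 'I_r,
  real_complex R (j i (Bplus z 1)) = phi z ^+ i.+1 + phi z ^- i.+1.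
Variables (K : fieldExtType rat) (e : nat -> {rmorphism K -> R[i]}) (T : K -> K).
Variables (iota : {rmorphism K -> R}) (tau : 'I_r -> {rmorphism K -> R[i]}).
Variable m : 'I_r -> 'I_r.
Hypothesis dimK : \dim {:K} = p.
Hypothesis e0 : forall x, e 0 x = real_complex R (iota x).
Hypothesis e_per : forall k, e (k + p)%N =1 e k.
Hypothesis e_conj : forall k x, (k <= p)%N -> e (p - k)%N x = conjc (e k x).
Hypothesis e_inj : forall k l, (k < p)%N -> (l < p)%N -> e k =1 e l -> k = l.
Hypothesis e_T : forall k u, e k (T u) = e k.+1 u * e (k + p.-1)%N u.
Hypothesis T_integral : forall u, alg_integer u -> alg_integer (T u).
Hypothesis m_inj : injective m.
Hypothesis tau_m : forall (k : 'I_r) u, normc (tau (m k) u) = normc (e k.+1 u).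

Local Notation B := (Bplus z).
Local Notation P := (Pmx j).
Local Notation U := (@units_OK K).
Local Notation sp := (spectral e j).

Let r1 : (1 < r)%N := r_gt1 p_prime p_ge5 r_def.
Let P_unit : P \in unitmx := Pmx_unit p_prime p_ge5 r_def z_prim j_spec.

(** The coordinates of Log are the log_coord k for 0 <= k <= r in some order,
    and log_coord r is minus the sum of the others: A is hyp_mx up to a
    permutation of its columns. *)
Lemma Log_linear : exists2 A : 'M[R]_(r, 1 + r),
  A *m A^T = hyp_mx R r *m (hyp_mx R r)^T &
  forall u, U u -> Log iota tau u = log_row r e u *m A.
Proof.
pose s := perm m_inj.
pose hy (k : 'I_r) (i : nat) : R := if i == r then -1 else (k == i :> nat)%:R.
pose A : 'M[R]_(r, 1 + r) :=
  row_mx (\col_k hy k 0%N) (\matrix_(k, l) hy k ((s^-1)%g l).+1).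
have sum_hy (f : 'I_r -> R) (i : nat) : (i < r)%N ->
    forall i' : 'I_r, i' = i :> nat -> \sum_k f k * hy k i = f i'.
  move=> ir i' ii'; rewrite (bigD1 i') //= /hy ltn_eqF // ii' eqxx mulr1.
  rewrite big1 ?addr0 // => k; rewrite -val_eqE /= ii' => /negPf ->.
  by rewrite mulr0.
have sum_r (f : 'I_r -> R) : \sum_k f k * hy k r = - \sum_k f k.
  by rewrite /hy eqxx -sumrN; apply: eq_bigr => k _; rewrite mulrN1.
exists A.
  rewrite /A /hyp_mx !tr_row_mx !mul_row_col trmx1 mulmx1.
  apply/matrixP => k l; rewrite !mxE !big_ord1 !mxE mulrN1 opprK.
  rewrite (reindex_inj (@perm_inj _ s)) /=.
  under eq_bigr do rewrite !mxE permK.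
  rewrite -(big_ord_recl _ (fun i => hy k i * hy l i)) big_ord_recr /=.
  rewrite {3 4}/hy eqxx mulrN1 opprK; congr (_ + _).
  rewrite (bigD1 k) //= {1 2}/hy ltn_eqF // eqxx mul1r.
  rewrite big1 ?addr0 => [|i]; first by rewrite eq_sym.
  by rewrite eq_sym => /negPf ik; rewrite {1}/hy ltn_eqF // val_eqE ik mul0r.
move=> u Uu; rewrite /Log /A mul_mx_row; congr row_mx.
  apply/matrixP => a b; rewrite !ord1 !mxE eqxx mulr1n.
  under eq_bigr do rewrite [X in _ * X]mxE.
  rewrite (sum_hy (log_row r e u 0) 0%N (ltnW r1) (Ordinal (ltnW r1))) //.
  by rewrite mxE /log_coord /log_emb e0 /= expr0n /= addr0 sqrtr_sqr.
apply/rowP => l; rewrite !mxE -{1}[l](permKV s) permE tau_m.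
set i := (s^-1)%g l; under eq_bigr do rewrite [X in _ * X]mxE -/i.
have [ir|ir] := ltnP i.+1 r.
  by rewrite (sum_hy (log_row r e u 0) _ ir (Ordinal ir)) // mxE.
have -> : i.+1 = r by apply/eqP; rewrite eqn_leq ir ltn_ord.
rewrite (sum_r (log_row r e u 0)).
have := sum_log_coord p_prime p_ge5 r_def dimK e_conj e_inj Uu.
rewrite big_ord_recr /= addrC => /eqP; rewrite addr_eq0 => /eqP.
rewrite {1}/log_coord gtn_eqF ?(ltnW r1) // => ->; congr (- _).
by apply: eq_bigr => k _; rewrite mxE.
Qed.

Variable u0 : K.
Hypothesis Uu0 : U u0.
Hypothesis u0_gt0 : forall l, 0 < sp u0 0 l.

(** The set of x in Q+ whose action on u0 is realized by a unit. It is a copy of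
    the unit lattice: x corresponds to the units u with
    spectral u = x * spectral u0. *)
Definition unit_module : set (Qplus z) :=
  [set x | exists2 u, U u & forall i, sp u 0 i = j i x * sp u0 0 i].

Lemma unit_module1 : unit_module 1.
Proof. by exists u0 => // i; rewrite rmorph1 mul1r. Qed.

Lemma unit_module0 : unit_module 0.
Proof.
exists 1 => [|i]; first exact: units1.
by rewrite spectral1 rmorph0 mul0r mxE.
Qed.

Lemma unit_moduleB x y : unit_module x -> unit_module y -> unit_module (x - y).
Proof.
move=> [u Uu ux] [v Uv vy]; exists (u * v^-1) => [|i].
  by apply: unitsM => //; exact: unitsV.
rewrite spectralM ?spectralV //; last exact: unitsV.
by rewrite [LHS]mxE [X in _ + X = _]mxE ux vy rmorphB mulrBl.
Qed.

Lemma unit_module_comb (I : finType) (f : I -> Qplus z) (c : I -> int) :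
  (forall k, unit_module (f k)) -> unit_module (\sum_k f k *~ c k).
Proof.
move=> mf; have /choice[h hP] : forall k, exists v, U v /\
    forall i, sp v 0 i = j i (f k) * sp u0 0 i.
  by move=> k; have [v ? ?] := mf k; exists v.
have [v Uv vE] := spectral_comb e j c (fun k => (hP k).1); exists v => // i.
rewrite vE summxE rmorph_sum mulr_suml; apply: eq_bigr => k _.
by rewrite mulrz_mxE (hP k).2 /= rmorphMz mulrzAl.
Qed.

(** It suffices to multiply by B_1, which is realized by T. *)
Lemma unit_module_stable a x : Aplus z a -> unit_module x -> unit_module (a * x).
Proof.
case=> q _ <-; elim/poly_ind: q x => [|q c IH] x mx.
  by rewrite rmorph0 horner0 mul0r; exact: unit_module0.
rewrite rmorphD rmorphM /= map_polyX map_polyC hornerMXaddC mulrDl -mulrA.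
have mBx : unit_module (B 1 * x).
  have [u Uu ux] := mx; exists (T u); first exact: unitsT.
  move=> i; rewrite (spectral_T p_prime p_ge5 r_def dimK e_per e_conj e_inj e_T T_integral
      z_prim j_spec) //.
  by rewrite ux rmorphM; ring.
have mcx : unit_module (- (c%:~R * x)).
  rewrite -mulNr -rmorphN /= mulrzl.
  have := unit_module_comb (I := 'I_1) (f := fun=> x) (fun=> - c) (fun=> mx).
  by rewrite big_ord1.
by rewrite -[c%:~R * x]opprK; apply: unit_moduleB => //; exact: IH.
Qed.

Lemma j_inj x y : (forall i, j i x = j i y) -> x = y.
Proof. by move=> E; apply: (fmorph_inj (j (Ordinal (ltnW r1)))). Qed.

Lemma Pmx_solve (c d : 'I_r -> R) :
  (forall i, \sum_(k < r) c k * j i (B k) = \sum_(k < r) d k * j i (B k)) -> forall k, c k = d k.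
Proof.
move=> cd k; suff /rowP/(_ k) : \row_k c k = \row_k d k by rewrite !mxE.
apply: (can_inj (mulmxK P_unit)); apply/rowP => i; rewrite /= !mxE.
transitivity (\sum_(k < r) c k * j i (B k)); first by apply: eq_bigr => l _; rewrite !mxE.
by rewrite cd; apply: eq_bigr => l _; rewrite !mxE.
Qed.

Let natr_neq0 (n : nat) : (0 < n)%N -> n%:R != 0 :> Qplus z.
Proof.
move=> n0; rewrite -(fmorph_eq0 (j (Ordinal (ltnW r1)))) rmorph_nat.
by rewrite pnatr_eq0 -lt0n.
Qed.

(** Let xi be the real vector such that spectral u is (sum_k xi_k B_k) acting on
    spectral u0. For each n, dividing u^n by units with integral coordinates
    leaves the fractional parts of n xi, which are bounded independently of u.
    Among n = 0, ..., N two of these agree, so (c - a) xi is integral for some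
    0 < c - a <= N, a divisor of N!. *)
Lemma unit_module_denominator : exists2 n : nat, (0 < n)%N &
  forall u, U u -> exists2 x : Qplus z, Aplus z (n%:R * x) &
    forall i, sp u 0 i = j i x * sp u0 0 i.
Proof.
have /choice[b bP] : forall k : 'I_r, exists v, U v /\
    forall i, sp v 0 i = j i (B k) * sp u0 0 i.
  move=> k; have [v Uv vk] := unit_module_stable (mem_Aplus_B z_prim k) unit_module1.
  by exists v; split=> // i; rewrite vk mulr1.
pose X : R := \sum_i \sum_(k < r) `|j i (B k) * sp u0 0 i|.
have [N NP] := finite_spectral p_prime p_ge5 r_def dimK e_conj e_inj z_prim j_spec X.
exists N`!; first exact: fact_gt0.
move=> u Uu.
pose xi : 'rV[R]_r := (\row_i (sp u 0 i / sp u0 0 i)) *m invmx P.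
have xiE i : \sum_(k < r) xi 0 k * j i (B k) = sp u 0 i / sp u0 0 i.
  have : xi *m P = \row_i (sp u 0 i / sp u0 0 i) by rewrite mulmxKV.
  move=> /rowP/(_ i); rewrite [LHS]mxE [RHS]mxE => <-.
  by apply: eq_bigr => k _; rewrite [X in _ = _ * X]mxE.
pose fl (n : nat) k := Num.floor (n%:R * xi 0 k).
pose fr (n : nat) k : R := n%:R * xi 0 k - (fl n k)%:~R.
have fr_itv n k : 0 <= fr n k < 1.
  have := floor_itv (n%:R * xi 0 k); rewrite -/(fl n k) /fr intrD mulr1z.
  by move=> /andP[h1 h2]; apply/andP; split; lra.
have /choice[h hP] : forall n : nat, exists v, U v /\
    forall i, sp v 0 i = (\sum_(k < r) fr n k * j i (B k)) * sp u0 0 i.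
  move=> n; have [v Uv vE] := spectral_power e j n Uu.
  have [w Uw wE] := spectral_comb e j (fun k => - fl n k) (fun k => (bP k).1).
  exists (v * w); split=> [|i]; first exact: unitsM.
  rewrite spectralM // vE wE [LHS]mxE summxE mulrz_mxE -mulrzl.
  have -> : sp u 0 i = (\sum_(k < r) xi 0 k * j i (B k)) * sp u0 0 i.
    by rewrite xiE divfK // lt0r_neq0.
  rewrite mulrA mulr_sumr !mulr_suml -big_split; apply: eq_bigr => k _ /=.
  by rewrite mulrz_mxE (bP k).2 -[in X in _ + X]mulrzl /fr rmorphN /=; ring.
have [a [c [ac cN E]]] : exists a c, [/\ (a < c)%N, (c <= N)%N & sp (h a) = sp (h c)].
  apply: NP => [n|n i]; first exact: (hP n).1.
  rewrite (hP n).2 mulr_suml; apply: le_trans (ler_norm_sum _ _ _) _.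
  rewrite /X [X in _ <= X](bigD1 i) //= ler_wpDr ?sumr_ge0 // => [l _|].
    by rewrite sumr_ge0.
  apply: ler_sum => k _; rewrite -mulrA normrM.
  have /andP[f0 f1] := fr_itv n k; rewrite ger0_norm //.
  by rewrite ler_piMl // ltW.
have fr_eq : forall k, fr a k = fr c k.
  apply: Pmx_solve => i; apply: (mulIf (lt0r_neq0 (u0_gt0 i))).
  by rewrite -!(hP _).2 E.
have ca0 : (0 < c - a)%N by rewrite subn_gt0.
have /dvdnP[q qE] : (c - a %| N`!)%N by rewrite dvdn_fact // ca0 (leq_trans (leq_subr _ _) cN).
pose g k := (fl c k - fl a k) * q.
have gE k : N`!%:R * xi 0 k = (g k)%:~R.
  rewrite /g qE natrM natrB ?(ltnW ac) // intrM rmorphB /= -mulrA mulrC.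
  by congr (_ * _); have := fr_eq k; rewrite /fr; lra.
exists ((N`!)%:R^-1 * \sum_(k < r) B k *~ g k).
  rewrite mulrA divff ?mul1r; first exact: (Aplus_sum z_prim).
  by rewrite natr_neq0 ?fact_gt0.
move=> i; rewrite rmorphM fmorphV rmorph_nat rmorph_sum /=.
rewrite -[LHS](divfK (lt0r_neq0 (u0_gt0 i))) -xiE; congr (_ * _).
apply: (@mulfI _ N`!%:R); first by rewrite pnatr_eq0 -lt0n fact_gt0.
rewrite mulrA divff ?mul1r ?pnatr_eq0 -?lt0n ?fact_gt0 // mulr_sumr.
by apply: eq_bigr => k _; rewrite mulrA gE rmorphMz mulrzl.
Qed.

Lemma unit_module_fractional : fractional_ideal unit_module.
Proof.
split.
- by exists 1; [exact: unit_module1 | exact: oner_neq0].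
- by split; [exact: unit_module0 | exact: unit_moduleB].
- exact: unit_module_stable.
have [n n0 nP] := unit_module_denominator; exists n%:R.
  split; last exact: natr_neq0.
  have A1 : Aplus z 1 by rewrite -(B0 z_prim); exact: (mem_Aplus_B z_prim).
  exact: (AplusMz (Posz n) A1).
move=> x [u Uu ux]; have [y Ay uy] := nP u Uu.
suff -> : x = y by [].
by apply: j_inj => i; apply: (mulIf (lt0r_neq0 (u0_gt0 i))); rewrite -ux.
Qed.

(** Units realizing a Z-basis of the module have logarithms that form a Z-basis
    of the unit lattice. Its matrix is X t Q up to a permutation of columns,
    where t absorbs both x0 and u0. *)
Lemma unit_shape_orbit (x0 : Qplus z) (v : 'I_r -> Qplus z) : x0 != 0 ->
  Zbasis [set x0 * x | x in unit_module] v ->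
  shape_image (torus_orbit j v) (unit_shape iota tau).
Proof.
move=> x00 vB.
have : Zbasis unit_module (fun k => x0^-1 * v k).
  have := Zbasis_scale (_ : x0^-1 != 0) vB; rewrite invr_eq0 x00 => /(_ isT).
  congr (Zbasis _ _); apply/seteqP; split=> [_ [_ [x mx <-] <-]|x mx].
    by rewrite mulKf.
  by exists (x0 * x); [exists x | rewrite mulKf].
move=> [mE free].
have /choice[eta etaP] : forall k, exists w, U w /\
    forall i, sp w 0 i = j i (x0^-1 * v k) * sp u0 0 i.
  move=> k; have : unit_module (x0^-1 * v k).
    by apply: (Zbasis_mem (conj mE free) k).
  by case=> w Uw wE; exists w.
have [A AA LogA] := Log_linear.
have LogE u : U u -> Log iota tau u = sp u *m P^T *m A.
  by move=> Uu; rewrite LogA // (spectralE p_prime p_ge5 r_def e z_prim j_spec).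
pose b : 'M[R]_(r, 1 + r) := \matrix_k Log iota tau (eta k).
have comb (c : 'I_r -> int) u : U u -> sp u = \sum_k sp (eta k) *~ c k ->
    Log iota tau u = \sum_k row k b *~ c k.
  move=> Uu uE; rewrite LogE // uE !mulmx_suml; apply: eq_bigr => k _.
  rewrite rowK (LogE _ (etaP k).1) -[sp _ *~ _]scaler_int -[RHS]scaler_int.
  by rewrite -!scalemxAl.
have sp_comb (c : 'I_r -> int) i : (\sum_k sp (eta k) *~ c k) 0 i =
    j i (\sum_k (x0^-1 * v k) *~ c k) * sp u0 0 i.
  rewrite summxE rmorph_sum mulr_suml; apply: eq_bigr => k _.
  by rewrite mulrz_mxE (etaP k).2 /= rmorphMz mulrzAl.
have bB : Zbasis (Log iota tau @` U) (fun k => row k b).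
  split.
    apply/seteqP; split=> [_ [u Uu <-]|_ [c _ <-]].
      have [x _ ux] : exists2 x, unit_module x & forall i, sp u 0 i = j i x * sp u0 0 i.
        have [n n0 nP] := unit_module_denominator; have [x _ ux] := nP u Uu.
        by exists x => //; exists u.
      have : unit_module x by exists u.
      rewrite mE => -[c _ cx]; exists c => //; apply/esym/comb => //.
      by apply/rowP => i; rewrite sp_comb cx.
    have [u Uu uE] := spectral_comb e j c (fun k => (etaP k).1).
    by exists u => //; exact: comb.
  move=> c c0; apply: free; apply: j_inj => i; rewrite rmorph0.
  apply: (mulIf (lt0r_neq0 (u0_gt0 i))); rewrite -sp_comb mul0r.
  have [u Uu uE] := spectral_comb e j c (fun k => (etaP k).1).
  have := comb c u Uu uE; rewrite c0 LogE // => E.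
  suff sp0 : sp u = 0 by rewrite -uE sp0 mxE.
  have [g gu gE] := Qmx_sqrt p_prime p_ge5 r_def z_prim j_spec.
  have : sp u *m (g *m g^T) = 0.
    rewrite -gE /Qmx trmx_mul !mulmxA -[_ *m hyp_mx R r *m _]mulmxA -AA mulmxA E.
    by rewrite !mul0mx.
  move=> /(congr1 (mulmxr (invmx (g *m g^T)))) /=.
  by rewrite mulmxK ?mul0mx // unitmx_mul unitmx_tr gu.
exists (b *m b^T); last by rewrite /unit_shape (lattice_shapeE bB).
rewrite (torus_orbitE p_prime p_ge5 r_def z_prim j_spec).
pose t : 'rV[R]_r := \row_i (j i x0^-1 * sp u0 0 i).
exists 1, (diag_mx t); split=> //.
  exists t => // i; rewrite mxE mulf_neq0 ?fmorph_eq0 ?invr_eq0 //.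
  exact: lt0r_neq0.
have bE : b = real_mx j v *m diag_mx t *m P^T *m A.
  apply/row_matrixP => k; rewrite rowK (LogE _ (etaP k).1) !row_mul; congr (_ *m _ *m _).
  rewrite -row_mul; apply/rowP => i; rewrite (etaP k).2 mul_mx_diag !mxE rmorphM; ring.
rewrite scale1r bE /Qmx !trmx_mul !mulmxA -[_ *m A *m A^T]mulmxA AA.
by rewrite !mulmxA.
Qed.

End UnitShape.

Theorem theorem1p3 (R : realType) (p r : nat)
  (p_prime : prime p) (p_ge5 : (5 <= p)%N) (r_def : r = ((p - 1) %/ 2)%N)
  (* zeta_p, as an element of a number field embedded in the complex numbers *)
  (F : fieldExtType rat) (z : F) (z_prim : p.-primitive_root z)
  (phi : {rmorphism F -> R[i]})
  (* the real embeddings of Q^+, in the prescribed order *)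
  (j : 'I_r -> {rmorphism Qplus z -> R})
  (j_spec : forall i : 'I_r,
     real_complex R (j i (Bplus z 1)) = phi z ^+ i.+1 + phi z ^- i.+1)
  (* for each ideal class, a representative and a Z-basis of it *)
  (rep : set (set (Qplus z)) -> set (Qplus z))
  (bas : set (set (Qplus z)) -> 'I_r -> Qplus z)
  (rep_spec : forall C, ideal_classes z C -> C (rep C))
  (bas_spec : forall C, ideal_classes z C -> Zbasis (rep C) (bas C))
  (* the D_p-extension K and its embeddings *)
  (K : fieldExtType rat) (K_Dp : Dp_extension p K)
  (iota : {rmorphism K -> R}) (tau : 'I_r -> {rmorphism K -> R[i]})
  (embK : embeddings_spec iota tau) :
  (forall C, ideal_classes z C ->
     is_translate_of_periodic_orbit (torus_orbit j (bas C)) /\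
     forall (a : set (Qplus z)) (v : 'I_r -> Qplus z),
       C a -> Zbasis a v ->
       shape_image (torus_orbit j v) = shape_image (torus_orbit j (bas C))) /\
  (exists2 C, ideal_classes z C &
     shape_image (torus_orbit j (bas C)) (unit_shape iota tau)).
Proof.
split=> [C CC|].
  have Crep := rep_spec C CC; have Cbas := bas_spec C CC.
  split; first exact: (torus_orbit_translate p_prime p_ge5 r_def z_prim j_spec CC Crep Cbas).
  move=> a v Ca av; apply/seteqP.
  split.
    exact: (torus_orbit_image_sub p_prime p_ge5 r_def z_prim j_spec CC Ca Crep av Cbas).
  exact: (torus_orbit_image_sub p_prime p_ge5 r_def z_prim j_spec CC Crep Ca Cbas av).
have pE := p_eq p_prime p_ge5 r_def.
have [e [T [m [[e0 e_per e_conj e_inj] e_T T_int [m_inj tau_m]]]]] :=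
  dihedral_embeddings p_prime pE K_Dp embK.
have dimK : \dim {:K} = p by case: K_Dp.
have [u0 Uu0 u0_neg] := pisot_unit p_prime p_ge5 r_def dimK
  (ex_intro _ (iota : K -> R) e0) e_conj e_inj.
have u0_gt0 := spectral_gt0 p_prime p_ge5 r_def dimK e_conj e_inj z_prim j_spec Uu0 u0_neg.
have fracI := unit_module_fractional p_prime p_ge5 r_def z_prim j_spec dimK e_per
  e_conj e_inj e_T T_int Uu0 u0_gt0.
pose C := ideal_class (unit_module j e u0).
have CC : ideal_classes z C by exists (unit_module j e u0).
exists C => //; have [x0 x00 repE] := rep_spec C CC.
have := bas_spec C CC; rewrite repE => basB.
exact: (unit_shape_orbit p_prime p_ge5 r_def z_prim j_spec dimK e0 e_per e_conj e_inj
  e_T T_int m_inj tau_m Uu0 u0_gt0 x00 basB).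
Qed.
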